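(* There exists an absolute constant $C>0$ such that the following holds. Let $G=(V,E)$ be an infinite, locally finite, connected, vertex-transitive, simple graph that is non-amenable, with degree $\Delta\ge3$ and girth $g\le\infty$. Then $$\left[\frac1{\Delta-1}+C\,\frac{\log(1+\lambda^{-2})}{g\Delta}\right]^{-1}\le\ \mu(G)\ \le\ \Delta-1,$$ where $\mu(G)$ is the connective constant of $G$ and $\lambda=\lambda(G)$ is the spectral bottom of simple random walk on $G$. Moreover, equality holds in the upper bound $\mu(G)\le\Delta-1$ if and only if $G$ is a tree, that is, $g=\infty$.
   Context: Girth: the infimum of the lengths of the circuits of $G$ (so $g=\infty$ if $G$ has no circuits, in which case the term with $g$ in the denominator is $0$). Amenability: the edge-isoperimetric constant is $\phi(G)=\inf\{|\partial_{\mathrm e}W|/(\Delta|W|): W\subset V,\ 0<|W|<\infty\}$, where $\partial_{\mathrm e}W$ is the set of edges between $W$ and $V\setminus W$. The graph $G$ is amenable if $\phi(G)=0$ and non-amenable otherwise. Connective constant: an $n$-step self-avoiding walk on $G$ is a walk with $n$ edges that visits no vertex more than once. Let $\sigma_n$ be the number of $n$-step self-avoiding walks starting at a fixed vertex. Then $\mu(G)=\lim_{n\to\infty}\sigma_n^{1/n}$. Spectral bottom: let $P$ be the transition matrix of simple random walk on $G$ and $I$ the identity matrix. Then $\lambda(G)$ is the largest $\lambda$ such that $\langle f,(I-P)f\rangle\ge\lambda\langle f,f\rangle$ for all $f\in\ell^2(V)$. (It is known that $\lambda(G)>0$ if and only if $G$ is non-amenable.) *)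

(* Defs.v *)
From HB Require Import structures.
From mathcomp Require Import all_boot all_order all_algebra.
From mathcomp Require Import finmap.
From mathcomp Require Import all_classical all_reals all_analysis.
Import Order.TTheory GRing.Theory Num.Theory.
Import numFieldNormedType.Exports.

Set Implicit Arguments.
Unset Strict Implicit.
Unset Printing Implicit Defensive.

Local Open Scope classical_set_scope.
Local Open Scope ring_scope.

(* Graphs on the vertex type V are given by their boolean adjacency relation;
   by classical logic, neither the choice structure on V nor the decidability
   of adjacency is a restriction. *)

Definition simple_graph (V : choiceType) (adj : rel V) : Prop :=
  symmetric adj /\ irreflexive adj.

Definition nbrs (V : choiceType) (adj : rel V) (x : V) : set V :=
  [set y | adj x y].

Definition locally_finite (V : choiceType) (adj : rel V) : Prop :=
  forall x, finite_set (nbrs adj x).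

(* Meaningful for locally finite graphs only: [fset_set] sends infinite sets to
   the empty set. *)
Definition degree (V : choiceType) (adj : rel V) (x : V) : nat :=
  #|` fset_set (nbrs adj x)|.

Definition graph_connected (V : choiceType) (adj : rel V) : Prop :=
  forall x y, exists p : seq V, path adj x p /\ last x p = y.

Definition graph_automorphism (V : choiceType) (adj : rel V) (f : V -> V) :
    Prop :=
  bijective f /\ forall x y, adj (f x) (f y) = adj x y.

Definition vertex_transitive (V : choiceType) (adj : rel V) : Prop :=
  forall x y, exists f, graph_automorphism adj f /\ f x = y.

(* A circuit is listed without repeating its starting point, so that [size c]
   is its number of edges; [2 < size c] excludes an edge run back and forth. *)
Definition circuit (V : choiceType) (adj : rel V) (c : seq V) : Prop :=
  ucycle adj c /\ (2 < size c)%N.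

Definition is_tree (V : choiceType) (adj : rel V) : Prop :=
  graph_connected adj /\ ~ exists c, circuit adj c.

Definition girth (R : realType) (V : choiceType) (adj : rel V) : \bar R :=
  ereal_inf [set ((size c)%:R)%:E | c in [set c | circuit adj c]].

(* An edge between W and its complement is recorded as the ordered pair whose
   first component is its endpoint in W, hence is counted once. *)
Definition edge_boundary (V : choiceType) (adj : rel V) (W : set V) :
    set (V * V) :=
  [set xy | [/\ W xy.1, ~ W xy.2 & adj xy.1 xy.2]].

Definition edge_isoperimetric (R : realType) (V : choiceType) (adj : rel V)
    (Delta : nat) : R :=
  inf [set (#|` fset_set (edge_boundary adj W)|)%:R
             / (Delta%:R * (#|` fset_set W|)%:R)
      | W in [set W | finite_set W /\ W !=set0]].

Definition amenable (R : realType) (V : choiceType) (adj : rel V)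
    (Delta : nat) : Prop :=
  edge_isoperimetric R adj Delta = 0.

Definition self_avoiding_walks (V : choiceType) (adj : rel V) (o : V) (n : nat) :
    set (seq V) :=
  [set p | [/\ size p = n, path adj o p & uniq (o :: p)]].

Definition num_saw (V : choiceType) (adj : rel V) (o : V) (n : nat) : nat :=
  #|` fset_set (self_avoiding_walks adj o n)|.

Definition connective_constant (R : realType) (V : choiceType) (adj : rel V)
    (o : V) : R :=
  lim ((((num_saw adj o n)%:R : R) `^ (n%:R)^-1) @[n --> \oo]).

Definition srw (R : realType) (V : choiceType) (adj : rel V) (x y : V) : R :=
  (adj x y)%:R / (degree adj x)%:R.

(* The function [P f] for P = srw; when the graph is locally finite, the sum
   over y has only finitely many nonzero terms. *)
Definition srw_op (R : realType) (V : choiceType) (adj : rel V) (f : V -> R) :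
    V -> R :=
  fun x => \sum_(y \in [set: V]) (srw R adj x y * f y).

Definition ell2 (R : realType) (V : choiceType) (f : V -> R) : Prop :=
  summable [set: V] (fun x => ((f x) ^+ 2)%:E).

(* The sum over V of the family f x * g x, absolutely summable for f and g in
   ell2, as the difference of the sums of its positive and negative parts. *)
Definition inner (R : realType) (V : choiceType) (f g : V -> R) : R :=
  let h : V -> \bar R := fun x => (f x * g x)%:E in
  fine (esum [set: V] h^\+ - esum [set: V] h^\-)%E.

Definition spectral_lower_bounds (R : realType) (V : choiceType)
    (adj : rel V) : set R :=
  [set l : R | forall f : V -> R, ell2 f ->
     l * inner f f <= inner f (fun x => f x - srw_op adj f x)].

(* The largest element of [spectral_lower_bounds]. *)
Definition spectral_bottom (R : realType) (V : choiceType) (adj : rel V) : R :=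
  let S : set R := spectral_lower_bounds adj in xget 0 (S `&` ubound S).

(* Main.v *)
(** Loop erasure bounds the Green function [g] of simple random walk by the
    generating function of self-avoiding walks: if at each vertex the closed
    walks avoiding one fixed neighbour have total weight at most [a], a walk is
    its loop erasure decorated with such closed walks, so
    [N + 1 <= b * \sum_(m <= N) sigma_m (a / Delta)^m] where [b] bounds
    [g(o, o)], and hence [mu >= Delta / a].

    When [1 / lambda <= 2^i] with [i] of order [girth / 8], the ball of radius
    [4 i] is a tree. The walk killed at a neighbour [x'] of [x] has a Green
    function that is subharmonic off [x] and of l2 norm at most [1 / lambda];
    averaging it over spheres of the tree gives
    [a <= Delta / (Delta - 1) + 2^-i], which is the claimed bound.

    Otherwise [ln (1 + lambda^-2)] is at least of order [girth], and it is
    enough that [mu >= Delta / 528] on every infinite transitive graph. If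
    [g(o, o)] is never large, loop erasure suffices. If it is, stop at an odd
    time where it is about 64: by positive semidefiniteness [g] cannot drop much
    across an edge, so the walk slightly damped at that time scale still has
    bounded loops but goes from any vertex to any neighbour with probability at
    least 3/8; loop erasure of the walks from [o] to a far vertex [z] then only
    produces self-avoiding walks of length at least [dist(o, z)], and their
    total weight is at least of order [(3 / 8) ^ dist(o, z)].

    Finally [mu <= Delta - 1] by counting extensions, with equality on trees,
    while a circuit of length [l] through every vertex makes every batch of [l]
    steps lose at least one of the [(Delta - 1)^l] extensions. *)

Require Import Defs.
From HB Require Import structures.
From mathcomp Require Import all_boot all_order all_algebra.
From mathcomp Require Import finmap.
From mathcomp Require Import all_classical all_reals all_analysis.
From mathcomp Require Import ring lra zify.
Import Order.TTheory GRing.Theory Num.Theory.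
Import numFieldNormedType.Exports.

Local Open Scope classical_set_scope.
Local Open Scope ring_scope.
Set Implicit Arguments.
Unset Strict Implicit.
Unset Printing Implicit Defensive.

(** * Walks and loop erasure *)

Section Walks.
Variables (R : realType) (V : choiceType) (adj : rel V) (nb : V -> seq V).
Hypotheses (nb_uniq : forall x, uniq (nb x))
  (mem_nb : forall x y, (y \in nb x) = adj x y).

Definition pt (x v : V) : R := (v == x)%:R.

Lemma pt_ge0 x v : 0 <= pt x v. Proof. by rewrite /pt ler0n. Qed.

Lemma pt_id x : pt x x = 1. Proof. by rewrite /pt eqxx. Qed.

Lemma pt_sym x y : pt x y = pt y x. Proof. by rewrite /pt eq_sym. Qed.

(* Sum of [w ^ (length) * f (endpoint)] over the walks from [v] with at most [N]
   steps that avoid [A] after their starting point. *)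
Fixpoint green (A : seq V) (w : R) (N : nat) (f : V -> R) (v : V) : R :=
  f v + (if N is N'.+1 then w * \sum_(y <- nb v | y \notin A) green A w N' f y
         else 0).

Lemma greenS A w N f v :
  green A w N.+1 f v = f v + w * \sum_(y <- nb v | y \notin A) green A w N f y.
Proof. by []. Qed.

Lemma green_ge0 A w N f v : 0 <= w -> (forall x, 0 <= f x) ->
  0 <= green A w N f v.
Proof.
move=> w0 f0; elim: N v => [|N IH] v; first by rewrite /= addr0.
by rewrite greenS addr_ge0// mulr_ge0// sumr_ge0.
Qed.

Lemma green_leS A w N f v : 0 <= w -> (forall x, 0 <= f x) ->
  green A w N f v <= green A w N.+1 f v.
Proof.
move=> w0 f0; elim: N v => [|N IH] v.
  by rewrite greenS /= addr0 lerDl mulr_ge0// sumr_ge0// => y _; rewrite addr0.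
rewrite [leRHS]greenS greenS lerD2l ler_wpM2l//.
by apply: ler_sum => y _; exact: IH.
Qed.

Lemma green_le A w M N f v : 0 <= w -> (forall x, 0 <= f x) -> (M <= N)%N ->
  green A w M f v <= green A w N f v.
Proof.
move=> w0 f0 /subnK <-; elim: (N - M)%N => [|k IH]; first by rewrite add0n.
by rewrite addSn (le_trans IH)// green_leS.
Qed.

Lemma green_sub A B w N f v : 0 <= w -> (forall x, 0 <= f x) ->
  {subset B <= A} -> green A w N f v <= green B w N f v.
Proof.
move=> w0 f0 BA; elim: N v => [|N IH] v //.
rewrite !greenS lerD2l ler_wpM2l// big_mkcond [leRHS]big_mkcond /=.
apply: ler_sum => y _; case: ifPn => [yA|_].
  by rewrite ifT ?IH//; apply: contra yA; exact: BA.
by case: ifP => // _; exact: green_ge0.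
Qed.

Lemma green_le_weight A w w' N f v : 0 <= w <= w' -> (forall x, 0 <= f x) ->
  green A w N f v <= green A w' N f v.
Proof.
move=> /andP[w0 ww'] f0; elim: N v => [|N IH] v //.
rewrite !greenS lerD2l ler_pM ?sumr_ge0// => [y _|]; first exact: green_ge0.
by apply: ler_sum => y _; exact: IH.
Qed.

(* The walks of [green A] started at [v] either avoid [x] or have a last visit
   to [x]; the last factor bounds what follows that visit. *)
Lemma green_last_visit A w N f x M v : 0 <= w -> (forall y, 0 <= f y) ->
  (M <= N.+1)%N ->
  green A w M f v <= (v != x)%:R * green (x :: A) w M f v
    + green A w M (pt x) v
      * (f x + w * \sum_(y <- nb x | y \notin x :: A) green (x :: A) w N f y).
Proof.
move=> w0 f0; set T := f x + _.
have T0 : f x <= T.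
  by rewrite lerDl mulr_ge0 ?sumr_ge0// => y _; exact: green_ge0.
elim: M v => [|M IH] v MN.
  rewrite /= !addr0 /pt; case: eqVneq => [->|_];
    last by rewrite !mul1r mul0r addr0.
  by rewrite mul0r add0r mul1r.
have {}IH := fun v => IH v (ltnW MN).
rewrite greenS (greenS A w M (pt x)).
have le1 : \sum_(y <- nb v | y \notin A) green A w M f y <=
   \sum_(y <- nb v | y \notin x :: A) green (x :: A) w M f y
   + (\sum_(y <- nb v | y \notin A) green A w M (pt x) y) * T.
  rewrite mulr_suml.
  have -> : \sum_(y <- nb v | y \notin x :: A) green (x :: A) w M f y =
      \sum_(y <- nb v | y \notin A) (y != x)%:R * green (x :: A) w M f y.
    rewrite [LHS]big_mkcond [RHS]big_mkcond; apply: eq_bigr => y _.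
    by rewrite inE negb_or; case: (y == x); case: (y \in A);
       rewrite /= ?mul0r ?mul1r.
  by rewrite -big_split; apply: ler_sum => y _; exact: IH.
have {le1} := ler_wpM2l w0 le1; rewrite mulrDr mulrA => le1.
rewrite {1}/pt; case: (eqVneq v x) le1 => [->|vx] le1.
  rewrite mul0r add0r mulrDl mul1r.
  have le2 : f x + w * \sum_(y <- nb x | y \notin x :: A)
      green (x :: A) w M f y <= T.
    by rewrite lerD2l ler_wpM2l//; apply: ler_sum => y _; exact: green_le.
  by move: le1 le2; lra.
by rewrite mul1r add0r greenS; lra.
Qed.

(** One vertex of the loop erasure is peeled off: up to its last visit to its start [x] a walk is
    closed, and afterwards it avoids [x]. *)
Lemma green_split A w N f x : 0 <= w -> (forall y, 0 <= f y) ->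
  green A w N.+1 f x <= green A w N.+1 (pt x) x
    * (f x + w * \sum_(y <- nb x | y \notin x :: A) green (x :: A) w N f y).
Proof.
move=> w0 f0; have := @green_last_visit A w N f x N.+1 x w0 f0 (leqnn _).
by rewrite eqxx /= mul0r add0r.
Qed.

(* Self-avoiding walks are recorded as in [self_avoiding_walks], without their
   starting point, which is allowed to lie in [A]. *)
Fixpoint saw (A : seq V) (n : nat) (x : V) : seq (seq V) :=
  if n is n'.+1 then
    flatten [seq [seq y :: p | p <- saw (x :: A) n' y]
            | y <- nb x & y \notin x :: A]
  else [:: [::]].

Lemma mem_saw A n x p : (p \in saw A n x) =
  [&& size p == n, path adj x p, uniq (x :: p) & ~~ has (mem A) p].
Proof.
elim: n A x p => [|n IH] A x p; first by case: p => [|y q];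
  rewrite in_cons ?in_nil.
apply/flattenP/idP => [[_ /mapP[y + ->]]|].
  rewrite mem_filter => /andP[yxA ynb] /mapP[q + ->].
  rewrite IH /= => /and4P[/eqP-> yq /andP[yNq qU] qA].
  move: yxA; rewrite inE negb_or => /andP[yx yA].
  rewrite eqxx -mem_nb ynb yq yNq qU !inE !negb_or yA (eq_sym x) yx /=.
  rewrite andbT; apply/andP; split.
    by apply: contra qA => xq; apply/hasP; exists x => //=; rewrite inE eqxx.
  apply: contra qA => /hasP[z zq zA]; apply/hasP; exists z => //.
  by rewrite /= inE orbC; move: zA => /= ->.
case: p => [|y q] //= /and4P[/eqP[sq] /andP[xy yq] /andP[+ /andP[yNq qU]]].
rewrite inE !negb_or => /andP[xy' xNq] /andP[yA qA].
exists [seq y :: p | p <- saw (x :: A) n y].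
  by apply/mapP; exists y => //; rewrite mem_filter inE negb_or mem_nb xy yA
     eq_sym xy'.
apply/mapP; exists q => //; rewrite IH /= sq eqxx yq yNq qU /=.
apply/hasPn => z zq; rewrite /= inE negb_or; apply/andP; split.
  by apply: contra xNq => /eqP <-.
by move/hasPn: qA => /(_ z zq).
Qed.

Lemma saw_uniq A n x : uniq (saw A n x).
Proof.
elim: n A x => [|n IH] A x //=.
have : uniq [seq y <- nb x | y \notin x :: A] by rewrite filter_uniq.
elim: [seq y <- nb x | y \notin x :: A] => //= y s IHs /andP[ys us].
rewrite cat_uniq IHs// andbT map_inj_uniq ?IH//; last by move=> p q [].
apply/hasPn => p /flattenP[_ /mapP[z zs ->]] /mapP[q _ ->].
by apply/negP => /mapP[r _ [zy _]]; move: ys; rewrite -zy zs.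
Qed.

Lemma big_saw A n x (F : V -> R) :
  \sum_(p <- saw A n.+1 x) F (last x p) =
  \sum_(y <- nb x | y \notin x :: A) \sum_(p <- saw (x :: A) n y) F (last y p).
Proof.
rewrite [saw _ _ _]/= big_flatten big_map big_filter; apply: eq_bigr => y _.
by rewrite big_map.
Qed.

(** The generating function of self-avoiding walks, truncated at length [N], written with the
    recursion of [green] so that the two compare by induction; [sawgfE] gives its power series
    form. *)
Fixpoint sawgf (c : R) (A : seq V) (N : nat) (f : V -> R) (x : V) : R :=
  f x + (if N is N'.+1 then
           c * \sum_(y <- nb x | y \notin x :: A) sawgf c (x :: A) N' f y
         else 0).

Lemma sawgfE c A N f x : sawgf c A N f x =
  \sum_(0 <= m < N.+1) c ^+ m * \sum_(p <- saw A m x) f (last x p).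
Proof.
elim: N A x => [|N IH] A x.
  by rewrite big_nat1 expr0 mul1r /= big_seq1 addr0.
rewrite big_nat_recl// expr0 mul1r /= big_seq1; congr (_ + _).
under eq_bigr do rewrite IH.
rewrite mulr_sumr; transitivity (\sum_(y <- nb x | y \notin x :: A)
    \sum_(0 <= m < N.+1)
      c ^+ m.+1 * \sum_(p <- saw (x :: A) m y) f (last y p)).
  apply: eq_bigr => y _; rewrite mulr_sumr; apply: eq_bigr => m _.
  by rewrite exprS mulrA.
rewrite exchange_big; apply: eq_bigr => m _.
by rewrite -/(saw A m.+1 x) big_saw mulr_sumr.
Qed.

(* Loop erasure: every vertex of the loop erasure except the first carries a
   closed walk avoiding its predecessor, of total weight at most [a]. *)
Lemma green_le_sawgf a w A x x' N f : 0 <= w -> 1 <= a ->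
  (forall y, 0 <= f y) ->
  (forall x x' M, adj x' x -> green [:: x'] w M (pt x) x <= a) ->
  adj x' x ->
  green (x' :: A) w N f x <= a * sawgf (a * w) (x' :: A) N f x.
Proof.
move=> w0 a1 f0 ha.
have a0 : 0 <= a by apply: le_trans a1.
elim: N A x x' => [|N IH] A x x' xx'.
  by rewrite /= !addr0 -[leLHS]mul1r ler_wpM2r.
apply: (le_trans (green_split _ _ _ w0 f0)).
have Ha : green (x' :: A) w N.+1 (pt x) x <= a.
  apply: le_trans (ha _ _ N.+1 xx'); apply: green_sub => // y.
  by rewrite inE => /eqP ->; rewrite mem_head.
have Hs : w * \sum_(y <- nb x | y \notin [:: x, x' & A])
               green [:: x, x' & A] w N f y <=
          a * w * \sum_(y <- nb x | y \notin [:: x, x' & A])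
               sawgf (a * w) [:: x, x' & A] N f y.
  rewrite -mulrA mulrCA ler_wpM2l// mulr_sumr big_seq_cond [leRHS]big_seq_cond.
  by apply: ler_sum => y /andP[]; rewrite mem_nb => xy _; exact: IH.
rewrite [sawgf _ _ _ _ _]/=; apply: ler_pM => //.
- exact: green_ge0.
- rewrite addr_ge0 ?mulr_ge0 ?sumr_ge0// => y _; exact: green_ge0.
- by rewrite lerD2l.
Qed.

(** The starting vertex has no predecessor to avoid, so its closed walks are unrestricted and are
    paid for by the separate bound [b]. *)
Lemma green0_le_sawgf a b w x N f : 0 <= w -> 1 <= a -> 0 <= b ->
  (forall y, 0 <= f y) ->
  (forall x x' M, adj x' x -> green [:: x'] w M (pt x) x <= a) ->
  (forall M, green [::] w M (pt x) x <= b) ->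
  green [::] w N.+1 f x <= b * sawgf (a * w) [::] N.+1 f x.
Proof.
move=> w0 a1 b0 f0 ha hb.
apply: (le_trans (green_split _ _ _ w0 f0)); rewrite [sawgf _ _ _ _ _]/=.
apply: ler_pM => //.
- exact: green_ge0.
- by rewrite addr_ge0 ?mulr_ge0 ?sumr_ge0// => y _; exact: green_ge0.
- rewrite lerD2l -mulrA mulrCA ler_wpM2l// mulr_sumr.
  rewrite big_seq_cond [leRHS]big_seq_cond.
  apply: ler_sum => y /andP[]; rewrite mem_nb => xy _.
  exact: green_le_sawgf.
Qed.

End Walks.

(** * The transition operator and its positivity *)

Section SymmetricWalk.
Variables (R : realType) (V : choiceType) (adj : rel V) (nb : V -> seq V).
Variable d : nat.
Hypotheses (adj_sym : symmetric adj) (nb_uniq : forall x, uniq (nb x))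
  (mem_nb : forall x y, (y \in nb x) = adj x y)
  (nb_size : forall x, size (nb x) = d) (d_gt0 : (0 < d)%N).

Local Notation pt := (@pt R V).
Local Notation green := (@green R V nb).

(** The transition operator [P] of simple random walk on a [d]-regular graph. *)
Definition avg (f : V -> R) (x : V) : R := d%:R^-1 * \sum_(y <- nb x) f y.

Let dR_gt0 : 0 < d%:R :> R. Proof. by rewrite ltr0n. Qed.

Lemma avg_ge0 f x : (forall y, 0 <= f y) -> 0 <= avg f x.
Proof. by move=> f0; rewrite mulr_ge0// sumr_ge0. Qed.

Lemma avg_le f h x : (forall y, f y <= h y) -> avg f x <= avg h x.
Proof. by move=> fh; rewrite ler_wpM2l// ler_sum. Qed.

Lemma avg_cst c x : avg (fun=> c) x = c.
Proof.
rewrite /avg big_const_seq count_predT nb_size iter_addr_0 -[c *+ _]mulr_natl.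
by rewrite mulKf// gt_eqF.
Qed.

Lemma avg_lin a b f h x :
  avg (fun v => a * f v + b * h v) x = a * avg f x + b * avg h x.
Proof. by rewrite /avg big_split -!mulr_sumr !mulrDr !(mulrCA a) !(mulrCA b).
  Qed.

Lemma green_nil_avgS N f v :
  green [::] d%:R^-1 N.+1 f v = f v + avg (green [::] d%:R^-1 N f) v.
Proof. by []. Qed.

Lemma green_iter N f v :
  green [::] d%:R^-1 N f v = \sum_(0 <= n < N.+1) iter n avg f v.
Proof.
elim: N v => [|N IH] v; first by rewrite big_nat1 /= addr0.
rewrite green_nil_avgS big_nat_recl//; congr (_ + _).
rewrite /avg (eq_bigr _ (fun y _ => IH y)) exchange_big mulr_sumr.
by apply: eq_bigr.
Qed.

Lemma green_lin A w N a b f h v :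
  green A w N (fun v => a * f v + b * h v) v =
  a * green A w N f v + b * green A w N h v.
Proof.
elim: N v => [|N IH] v; first by rewrite /= !addr0.
rewrite !greenS (eq_bigr _ (fun y _ => IH y)) big_split -!mulr_sumr /=.
by ring.
Qed.

Lemma avg_pt y v : avg (pt y) v = d%:R^-1 * \sum_(z <- nb y) pt z v.
Proof.
congr (_ * _); suff E u w : \sum_(z <- nb u) pt w z = (adj u w)%:R.
  by rewrite E adj_sym -E; apply: eq_bigr => z _; rewrite pt_sym.
rewrite -mem_nb; case: (boolP (w \in nb u)) => wu.
  rewrite (bigD1_seq w)//= pt_id big1_seq ?addr0// => z /andP[zw _].
  by rewrite /pt (negbTE zw).
by rewrite big1_seq// => z /= zu; rewrite /pt; case: eqVneq zu wu => // -> ->.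
Qed.

Lemma iter_avg_sum n (s : seq V) c (F : V -> V -> R) v :
  iter n avg (fun v => c * \sum_(z <- s) F z v) v =
  c * \sum_(z <- s) iter n avg (F z) v.
Proof.
elim: n v => [|n IH] v //; rewrite iterS {1}/avg (eq_bigr _ (fun y _ => IH y)).
rewrite -mulr_sumr mulrCA exchange_big; congr (_ * _).
by rewrite mulr_sumr; apply: eq_bigr.
Qed.

Lemma iter_avg_sym n x y : iter n avg (pt x) y = iter n avg (pt y) x.
Proof.
elim: n x y => [|n IH] x y; first exact: pt_sym.
rewrite iterSr (_ : avg (pt x) = fun v => d%:R^-1 * \sum_(z <- nb x) pt z v).
  rewrite iter_avg_sum iterS {1}/avg; congr (_ * _).
  by apply: eq_bigr => z _; rewrite IH.
by apply/funext => v; exact: avg_pt.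
Qed.

Lemma green_sym N x y :
  green [::] d%:R^-1 N (pt x) y = green [::] d%:R^-1 N (pt y) x.
Proof. by rewrite !green_iter; apply: eq_bigr => n _; exact: iter_avg_sym. Qed.

Lemma avg_aut (phi : V -> V) f x : bijective phi ->
  (forall x y, adj (phi x) (phi y) = adj x y) ->
  avg f (phi x) = avg (f \o phi) x.
Proof.
move=> [psi phiK psiK] hphi; congr (_ * _).
rewrite -(big_map phi xpredT f); apply: perm_big; apply: uniq_perm => //.
  by rewrite map_inj_uniq//; exact: can_inj phiK.
move=> y; rewrite mem_nb -{1}(psiK y) hphi -mem_nb; apply/idP/mapP => [yx|].
  by exists (psi y).
by move=> [z zx ->]; rewrite phiK.
Qed.

Lemma green_aut N (phi : V -> V) x y : bijective phi ->
  (forall x y, adj (phi x) (phi y) = adj x y) ->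
  green [::] d%:R^-1 N (pt (phi x)) (phi y) = green [::] d%:R^-1 N (pt x) y.
Proof.
move=> bphi hphi; rewrite !green_iter; apply: eq_bigr => n _.
elim: n y => [|n IH] y /=; first by rewrite /pt (inj_eq (bij_inj bphi)).
by rewrite avg_aut//; congr (_ * _); apply: eq_bigr => z _; exact: IH.
Qed.

(** Finitely supported functions carry a list containing their support, so that inner products
    become finite sums. *)
Definition supp (f : V -> R) (F : seq V) := forall x, x \notin F -> f x = 0.

Lemma supp_sub f F F' : {subset F <= F'} -> supp f F -> supp f F'.
Proof. by move=> FF' fF x xF'; apply: fF; apply: contra xF'; exact: FF'. Qed.

Lemma sum_supp (A F : seq V) f : uniq A -> uniq F -> supp f F ->
  \sum_(y <- A) f y = \sum_(y <- F) (y \in A)%:R * f y.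
Proof.
move=> uA uF fF.
rewrite (bigID (mem F)) /= [X in _ + X]big1 ?addr0 => [|i /fF//].
rewrite [RHS](bigID (mem A)) /= [X in _ = _ + X]big1 ?addr0 => [|i]; last first.
  by move=> /negbTE ->; rewrite mul0r.
rewrite [RHS](eq_bigr f) => [|i ->]; last by rewrite mul1r.
rewrite -[LHS]big_filter -[RHS]big_filter; apply: perm_big; apply: uniq_perm;
  rewrite ?filter_uniq//.
by move=> x; rewrite !mem_filter andbC.
Qed.

Lemma sum_suppW (F F' : seq V) f : uniq F -> uniq F' -> supp f F -> supp f F' ->
  \sum_(y <- F) f y = \sum_(y <- F') f y.
Proof.
move=> uF uF' fF fF'; rewrite (sum_supp uF uF' fF'); apply: eq_bigr => y _.
by case: (boolP (y \in F)) => [|/fF ->]; rewrite ?mul1r ?mulr0.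
Qed.

Lemma sum_pt (F : seq V) x f : uniq F -> x \in F ->
  \sum_(y <- F) pt x y * f y = f x.
Proof.
move=> uF xF; rewrite (bigD1_seq x)//= pt_id mul1r big1 ?addr0// => z zx.
by rewrite /pt (negbTE zx) mul0r.
Qed.

Lemma avg_dot (F : seq V) f h : uniq F -> supp f F -> supp h F ->
  \sum_(x <- F) f x * avg h x = \sum_(x <- F) avg f x * h x.
Proof.
move=> uF fF hF.
have E k x : supp k F -> avg k x = d%:R^-1 * \sum_(y <- F) (adj x y)%:R * k y.
  move=> kF; rewrite /avg (sum_supp _ uF kF)//; congr (_ * _).
  by apply: eq_bigr => y _; rewrite mem_nb.
under eq_bigr do rewrite E// mulrCA mulr_sumr.
under [RHS]eq_bigr do rewrite E// -mulrA mulr_suml.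
rewrite -!mulr_sumr exchange_big; congr (_ * _); apply: eq_bigr => x _.
by apply: eq_bigr => y _; rewrite adj_sym; ring.
Qed.

Lemma supp_avg f F : supp f F -> supp (avg f) (F ++
  flatten [seq nb x | x <- F]).
Proof.
move=> fF x; rewrite mem_cat negb_or => /andP[_ xF].
rewrite /avg big1_seq ?mulr0// => y /andP[_ yx]; apply: fF.
apply: contra xF => yF; apply/flattenP; exists (nb y); first exact: map_f.
by rewrite mem_nb adj_sym -mem_nb.
Qed.

(** One list serves all the powers up to [n], so that self-adjointness can be applied repeatedly
    over a fixed range of summation. *)
Lemma supp_iter f F n : supp f F ->
  exists F', [/\ uniq F', {subset F <= F'} &
    forall j, (j <= n)%N -> supp (iter j avg f) F'].
Proof.
move=> fF; elim: n => [|n [F' [uF' FF' hF']]].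
  exists (undup F); split; [exact: undup_uniq|by move=> x; rewrite mem_undup|].
  move=> j; rewrite leqn0 => /eqP ->; apply: supp_sub fF => x.
  by rewrite mem_undup.
exists (undup (F' ++ flatten [seq nb x | x <- F'])); split.
- exact: undup_uniq.
- by move=> x /FF' xF'; rewrite mem_undup mem_cat xF'.
- move=> j; rewrite leq_eqVlt => /orP[/eqP ->|jn].
    apply: supp_sub (supp_avg (hF' n (leqnn _))) => x.
    by rewrite mem_undup.
  by apply: supp_sub (hF' j jn) => x xF'; rewrite mem_undup mem_cat xF'.
Qed.

(** After pairing with the indicator of [F], self-adjointness moves [avg] onto that indicator, whose
    average is at most 1. *)
Lemma sum_avg_le F f : uniq F -> supp f F -> (forall x, 0 <= f x) ->
  \sum_(x <- F) avg f x <= \sum_(x <- F) f x.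
Proof.
move=> uF fF f0; pose i x : R := (x \in F)%:R.
have iF : supp i F by move=> x /negbTE; rewrite /i => ->.
have -> : \sum_(x <- F) avg f x = \sum_(x <- F) i x * avg f x.
  by apply: eq_big_seq => x; rewrite /i => ->; rewrite mul1r.
rewrite avg_dot//; apply: ler_sum => x _; rewrite ler_piMl//.
by rewrite -[leRHS](avg_cst 1 x); apply: avg_le => y; rewrite /i lern1 leq_b1.
Qed.

(** This is [P >= -1]: the squares [(f x + f y) ^+ 2] are averaged over the edges. *)
Lemma dot_avg_ge F f : uniq F -> supp f F ->
  0 <= \sum_(x <- F) f x * f x + \sum_(x <- F) f x * avg f x.
Proof.
move=> uF fF; pose q x := f x * f x.
have qF : supp q F by move=> x /fF; rewrite /q => ->; rewrite mul0r.
have q0 x : 0 <= q x by rewrite /q -expr2 sqr_ge0.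
have := sum_avg_le uF qF q0; rewrite -subr_ge0 => le1.
suff : \sum_(x <- F) (- (q x + avg q x)) <= 2 * \sum_(x <- F) f x * avg f x.
  by rewrite sumrN big_split /= -/(q _); lra.
rewrite mulr_sumr; apply: ler_sum => x _.
have -> : 2 * (f x * avg f x) = avg (fun y => 2 * f x * f y + 0 * f y) x.
  by rewrite avg_lin; ring.
have -> : - (q x + avg q x) = avg (fun y => (-1) * q x + (-1) * q y) x.
  by rewrite avg_lin avg_cst; ring.
by apply: avg_le => y; have := sqr_ge0 (f x + f y); rewrite /q; nra.
Qed.

(* The sum of the powers [0, ..., 2 k + 1] of [avg] splits into the pairs
   [avg ^ (2 i) + avg ^ (2 i + 1)], each positive since [avg >= -1]. *)
Lemma green_psd F f k : uniq F -> supp f F ->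
  0 <= \sum_(x <- F) f x * green [::] d%:R^-1 k.*2.+1 f x.
Proof.
move=> uF fF; have [F' [uF' FF' hF']] := supp_iter k.*2.+1 fF.
have -> : \sum_(x <- F) f x * green [::] d%:R^-1 k.*2.+1 f x =
          \sum_(x <- F') f x * green [::] d%:R^-1 k.*2.+1 f x.
  by apply: sum_suppW => // x; [move=> /fF ->|move=> /(hF' 0%N erefl) /= ->];
    rewrite mul0r.
under eq_bigr do rewrite green_iter mulr_sumr.
rewrite exchange_big /=.
(* Self-adjointness moves powers of [avg] from one factor to the other. *)
have shift i j : (i + j <= k.*2.+1)%N ->
    \sum_(x <- F') iter i avg f x * iter j avg f x =
    \sum_(x <- F') f x * iter (i + j) avg f x.
  elim: i j => [|i IH] j ij //; rewrite addSnnS -IH ?addnS//.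
  rewrite -avg_dot//; apply: hF'; lia.
pose T i := \sum_(x <- F') f x * iter i avg f x; rewrite -/(T _).
suff : forall m, (m <= k)%N -> 0 <= \sum_(0 <= i < m.*2.+2) T i by exact.
elim=> [|m IH] mk; rewrite ?doubleS big_nat_recr// big_nat_recr//=; last first.
  rewrite -addrA addr_ge0//; first exact: IH (ltnW mk).
  have -> : T m.*2.+2 = T (m.+1 + m.+1)%N by congr T; lia.
  have -> : T m.*2.+3 = T (m.+1 + m.+2)%N by congr T; lia.
  by rewrite /T -!shift; [apply: (dot_avg_ge uF'); apply: hF'; lia|lia|lia].
rewrite big_nil add0r; apply: (dot_avg_ge uF'); exact: (hF' 0%N).
Qed.

(* The squared distance [g(x,x) + g(y,y) - 2 g(x,y)] attached to a positive
   semidefinite kernel satisfies a relaxed triangle inequality. *)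
Lemma green_triangle k x y z :
  4 * green [::] d%:R^-1 k.*2.+1 (pt x) y +
    4 * green [::] d%:R^-1 k.*2.+1 (pt x) z
  <= 4 * green [::] d%:R^-1 k.*2.+1 (pt x) x +
    green [::] d%:R^-1 k.*2.+1 (pt y) y
     + green [::] d%:R^-1 k.*2.+1 (pt z) z +
       2 * green [::] d%:R^-1 k.*2.+1 (pt y) z.
Proof.
set g := green [::] d%:R^-1 k.*2.+1.
(* Positivity is tested on [pt y + pt z - 2 pt x], written in the shape that [green_lin] expects. *)
pose u v := 1 * (1 * pt y v + 1 * pt z v) + (- 2) * pt x v.
have uF : supp u (undup [:: x; y; z]).
  move=> v; rewrite mem_undup !inE !negb_or => /and3P[vx vy vz].
  by rewrite /u /pt (negbTE vx) (negbTE vy) (negbTE vz); ring.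
have := green_psd k (undup_uniq _) uF.
rewrite -/(g u).
have gu v : g u v = 1 * (1 * g (pt y) v + 1 * g (pt z) v) + (- 2) * g (pt x) v.
  by rewrite /g /u !green_lin.
set F := undup _; have inF v : v \in [:: x; y;
  z] -> v \in F by rewrite mem_undup.
have -> : \sum_(v <- F) u v * g u v = g u y + g u z - 2 * g u x.
  rewrite -[g u y](sum_pt (g u) (undup_uniq [:: x; y; z]) (inF y _)).
    rewrite -[g u z](sum_pt (g u) (undup_uniq [:: x; y; z]) (inF z _)).
      rewrite -[g u x](sum_pt (g u) (undup_uniq [:: x; y; z]) (inF x _)).
        rewrite mulr_sumr -big_split -sumrB; apply: eq_bigr => v _.
        by rewrite /u /=; ring.
      by rewrite !inE eqxx.
    by rewrite !inE eqxx !orbT.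
  by rewrite !inE eqxx !orbT.
rewrite !gu.
have := green_sym k.*2.+1 x y; have := green_sym k.*2.+1 x z.
by have := green_sym k.*2.+1 y z; rewrite -/g; lra.
Qed.

End SymmetricWalk.

(** Bernoulli's inequality as an upper bound on [(1 - x) ^+ n]; it is applied with [n x = 1] and
    with [n x = 1 / 2]. *)
Lemma bernoulli_inv (R : realFieldType) (x : R) n : 0 <= x <= 1 ->
  (1 - x) ^+ n * (1 + n%:R * x) <= 1.
Proof.
move=> /andP[x0 x1]; elim: n => [|n IH];
  first by rewrite expr0 mul1r mul0r addr0.
apply: le_trans IH; rewrite exprSr -mulrA ler_wpM2l ?exprn_ge0 ?subr_ge0//.
by rewrite -natr1; have : 0 <= n%:R :> R by []; nra.
Qed.

(** * Decrease of the Green function across an edge *)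

Section EdgeDrop.
Variables (R : realType) (V : choiceType) (adj : rel V) (nb : V -> seq V).
Variable d : nat.
Hypotheses (adj_sym : symmetric adj) (nb_uniq : forall x, uniq (nb x))
  (mem_nb : forall x y, (y \in nb x) = adj x y)
  (nb_size : forall x, size (nb x) = d) (d_gt0 : (0 < d)%N).

Local Notation pt := (@pt R V).
Local Notation green := (@green R V nb).
Local Notation avg := (@avg R V nb d).
Local Notation g k := (green [::] d%:R^-1 k.*2.+1).

Variables (k : nat) (U gamma : R) (nx : V -> V).
Hypotheses (diagU : forall x, g k (pt x) x = U)
  (nx_adj : forall x, adj x (nx x))
  (nx_val : forall x, g k (pt x) (nx x) = gamma).

Let dR_gt0 : 0 < d%:R :> R. Proof. by rewrite ltr0n. Qed.
Let dV_ge0 : 0 <= d%:R^-1 :> R. Proof. by rewrite invr_ge0 ler0n. Qed.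

(* The walk that is killed when it uses the edge [(x, nx x)]. *)
Let A (f : V -> R) (x : V) : R := d%:R^-1 * \sum_(y <- nb x | y != nx x) f y.

Let avgE f x : avg f x = A f x + d%:R^-1 * f (nx x).
Proof.
rewrite /avg (bigD1_seq (nx x)) ?mem_nb//= mulrDr addrC.
by [].
Qed.

Let A_le f h x : (forall y, f y <= h y) -> A f x <= A h x.
Proof. by move=> fh; rewrite ler_wpM2l// ler_sum. Qed.

Let iterA_le n f h x : (forall y, f y <= h y) -> iter n A f x <= iter n A h x.
Proof. by move=> fh; elim: n x => [|n IH] x //=; exact: A_le. Qed.

Let A_lin a b f h x : A (fun v => a * f v + b * h v) x = a * A f x + b * A h x.
Proof. by rewrite /A big_split -!mulr_sumr !mulrDr !(mulrCA a) !(mulrCA b). Qed.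

Let iterA_lin n a b f h x :
  iter n A (fun v => a * f v + b * h v) x = a * iter n A f x + b * iter n A h x.
Proof.
elim: n x => [|n IH] x //=; rewrite -A_lin; congr (_ * _).
by apply: eq_bigr => y _.
Qed.

Let A_cst c x : A (fun=> c) x = (1 - d%:R^-1) * c.
Proof. by have := avgE (fun=> c) x; rewrite avg_cst//; lra. Qed.

Let iterA_cst n x : iter n A (fun=> 1) x = (1 - d%:R^-1) ^+ n.
Proof.
elim: n x => [|n IH] x //=; rewrite exprS -(A_cst _ x); congr (_ * _).
by apply: eq_bigr => y _; exact: IH.
Qed.

(** A single step lands on [x] with probability at most [1 / d], and further steps of the killed
    walk only average this bound. *)
Let iterA_pt n x v : iter n.+1 A (pt x) v <= d%:R^-1.
Proof.
have d1 : d%:R^-1 <= 1 :> R by rewrite invf_le1// ler1n.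
elim: n v => [|n IH] v.
  have : A (pt x) v <= avg (pt x) v.
    by rewrite avgE lerDl mulr_ge0// ?pt_ge0.
  move=> /le_trans; apply; rewrite (avg_pt R d adj_sym nb_uniq mem_nb).
  rewrite -[leRHS]mulr1 ler_wpM2l//; case: (boolP (v \in nb x)) => vx.
    by rewrite (bigD1_seq v)//= pt_id big1 ?addr0// => z zv;
      rewrite /pt eq_sym (negbTE zv).
  rewrite big1_seq ?ler01// => z /= zx; rewrite /pt; case: eqVneq => // vz.
  by rewrite vz zx in vx.
rewrite iterS; apply: (@le_trans _ _ (A (fun=> d%:R^-1) v)).
  by apply: A_le => y; exact: IH.
by rewrite A_cst ler_piMl// gerBl.
Qed.

(** Time 0 contributes 1, and the [d - 1] other times at most [1 / d] each. *)
Let sum_iterA_pt x : \sum_(0 <= t < d) iter t A (pt x) x <= 2.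
Proof.
case: d d_gt0 iterA_pt => // n _ ipt; rewrite big_nat_recl//= pt_id.
have -> : 2 = 1 + 1 :> R by []; rewrite lerD2l.
apply: (@le_trans _ _ (\sum_(0 <= t < n) n.+1%:R^-1)).
  by apply: ler_sum => t _; exact: ipt.
rewrite big_const_nat subn0 iter_addr_0 -[_ *+ n]mulr_natl.
by rewrite ler_pdivrMr ?ltr0n// mul1r ler_nat.
Qed.

(* In [d] steps the walk returns to its start [O(1)] times, but crosses the edge
   [(v, nx v)] at its current position [v] with probability at least 1/2; hence
   the kernel cannot drop much across these edges. *)
Lemma green_edge_drop (x : V) : U - gamma <= 16.
Proof.
pose f v := U - g k (pt x) v.
(* The triangle inequality with two equal points bounds the kernel by its diagonal. *)
have gle y v : g k (pt y) v <= U.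
  have := green_triangle R adj_sym nb_uniq mem_nb nb_size d_gt0 k y v v.
  by rewrite !diagU; lra.
have f0 v : 0 <= f v by rewrite subr_ge0.
(* The drop [f] is superharmonic up to a unit source at [x]. *)
have avgf v : avg f v <= f v + pt x v.
  have -> : avg f v = U - avg (g k (pt x)) v.
    rewrite -[in RHS](avg_cst nb_size d_gt0 U v) /avg -mulrBr -sumrB.
    by apply: congr1.
  rewrite /f green_nil_avgS.
  have : avg (green [::] d%:R^-1 k.*2 (pt x)) v <= avg (g k (pt x)) v.
    by apply: avg_le => y; apply: green_leS => // z; exact: pt_ge0.
  by lra.
have iterf t : iter t A f x <= f x + \sum_(0 <= j < t) iter j A (pt x) x.
  elim: t => [|t IH]; first by rewrite big_nil addr0.
  rewrite big_nat_recr//= addrA; apply: le_trans (lerD IH (lexx _)).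
  rewrite -/(iter t.+1 A f) iterSr.
  have := iterA_lin t 1 1 f (pt x) x; rewrite !mul1r => <-.
  apply: iterA_le => v; rewrite !mul1r; apply: le_trans (avgf v).
  by rewrite avgE lerDl mulr_ge0.
have fx : f x = 0 by rewrite /f diagU subrr.
have s1 : d%:R^-1 * \sum_(0 <= t < d) iter t A f x <= 2.
  rewrite ler_pdivrMl//; apply: (@le_trans _ _ (\sum_(0 <= t < d) 2)).
    rewrite big_nat [leRHS]big_nat; apply: ler_sum => t /andP[_ td].
    apply: (le_trans (iterf t)); rewrite fx add0r.
    apply: le_trans (sum_iterA_pt x).
    rewrite [leRHS](big_cat_nat (n := t))//=; last exact: ltnW.
    rewrite lerDl; apply: sumr_ge0 => j _.
    elim: j (x) {2}(x) => [|j IH] y z /=; first exact: pt_ge0.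
    by rewrite mulr_ge0// sumr_ge0.
  by rewrite big_const_nat subn0 iter_addr_0 -[_ *+ _]mulr_natl mulrC lexx.
(* Splitting [avg] into [A] and the killed edge makes the sum telescope; it starts from [f x = 0]
   and is fed only by the returns to [x]. *)
have s2 : d%:R^-1 * \sum_(0 <= t < d) iter t A (f \o nx) x <= 2.
  have step t : iter t.+1 A f x + d%:R^-1 * iter t A (f \o nx) x
      <= iter t A f x + iter t A (pt x) x.
    rewrite iterSr.
    have := iterA_lin t 1 d%:R^-1 (A f) (f \o nx) x; rewrite mul1r => <-.
    have := iterA_lin t 1 1 f (pt x) x; rewrite !mul1r => <-.
    by apply: iterA_le => v; rewrite !mul1r /= -avgE.
  have {step} : forall T, iter T A f x +
      d%:R^-1 * \sum_(0 <= t < T) iter t A (f \o nx) x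
      <= \sum_(0 <= t < T) iter t A (pt x) x.
    elim=> [|T IH]; first by rewrite !big_nil mulr0 addr0 /= fx.
    by rewrite !big_nat_recr//= mulrDr; have := step T; rewrite iterS; lra.
  move=> /(_ d) ; have := sum_iterA_pt x.
  have : 0 <= iter d A f x.
    elim: (d) (x) => [|j IH] y //=.
    by rewrite mulr_ge0// sumr_ge0.
  by lra.
(* The relaxed triangle inequality for [x], [v], [nx v]; it is then averaged over the killed walk at
   times below [d]. *)
have tri v : (U - gamma) * 1 <= 2 * f v + 2 * (f \o nx) v.
  have := green_triangle R adj_sym nb_uniq mem_nb nb_size d_gt0 k x v (nx v).
  by rewrite !diagU nx_val /f /=; lra.
have {tri} tri t : (U - gamma) * (1 - d%:R^-1) ^+ t <=
    2 * iter t A f x + 2 * iter t A (f \o nx) x.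
  rewrite -(iterA_cst t x) -iterA_lin -[leLHS]addr0 -[X in _ +
    X](mul0r (iter t A f x)).
  by rewrite -iterA_lin; apply: iterA_le => v; rewrite mul0r addr0.
have : (U - gamma) * (d%:R^-1 * \sum_(0 <= t < d) (1 - d%:R^-1) ^+ t) <= 8.
  rewrite mulrCA mulr_sumr.
  apply: (@le_trans _ _ (d%:R^-1 * \sum_(0 <= t < d)
     (2 * iter t A f x + 2 * iter t A (f \o nx) x))).
    by rewrite ler_wpM2l//; apply: ler_sum => t _; exact: tri.
  by rewrite big_split -!mulr_sumr mulrDr !(mulrCA _ 2) /=; lra.
(* The mean survival probability is a geometric sum, at least [1 / 2] since
   [(1 - 1 / d) ^ d <= 1 / 2]; hence the bound [16 = 2 * 8]. *)
have -> : d%:R^-1 * \sum_(0 <= t < d) (1 - d%:R^-1) ^+ t =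
    1 - (1 - d%:R^-1) ^+ d :> R.
  rewrite big_mkord; have := subrX1 (1 - d%:R^-1 : R) d.
  by rewrite (_ : 1 - d%:R^-1 - 1 = - d%:R^-1 :> R); [lra|ring].
have : (1 - d%:R^-1 : R) ^+ d <= 1 / 2.
  have := @bernoulli_inv R d%:R^-1 d _; rewrite mulfV ?gt_eqF//.
  rewrite dV_ge0 invf_le1// ler1n d_gt0 => /(_ isT).
  by rewrite -[1 + 1]/2 -ler_pdivlMr.
have : 0 <= U - gamma by rewrite subr_ge0 -(nx_val x).
by nra.
Qed.

End EdgeDrop.

(** * Hitting weights and damped walks *)

Section Hitting.
Variables (R : realType) (V : choiceType) (nb : V -> seq V).
Variable d : nat.
Hypothesis nb_size : forall x, size (nb x) = d.

Local Notation pt := (@pt R V).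
Local Notation green := (@green R V nb).

(* Weight of the walks from [v] that reach [y] within [M] steps, stopped at
   their first visit to [y]. *)
Fixpoint hit (w : R) (M : nat) (y v : V) : R :=
  if M is M'.+1 then if v == y then 1 else w * \sum_(u <- nb v) hit w M' y u
  else pt y v.

Lemma hit_ge0 w M y v : 0 <= w -> 0 <= hit w M y v.
Proof.
move=> w0; elim: M v => [|M IH] v /=; first exact: pt_ge0.
by case: ifP => // _; rewrite mulr_ge0// sumr_ge0.
Qed.

(** Decomposition at the first visit to [y]: what follows is a walk from [y] with at most [M]
    steps. *)
Lemma green_le_hit w M y v : 0 <= w ->
  green [::] w M (pt y) v <= hit w M y v * green [::] w M (pt y) y.
Proof.
move=> w0; set U := green _ _ _ _ y.
have U1 : 1 <= U.
  apply: le_trans (green_le nb [::] y w0 (pt_ge0 R y) (leq0n M)).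
  by rewrite /= addr0 pt_id.
suff : forall m, (m <= M)%N -> green [::] w m (pt y) v <= hit w m y v * U.
  exact.
move=> m; elim: m v => [|m IH] v mM.
  by rewrite /= addr0 ler_peMr// pt_ge0.
rewrite greenS /= /pt; case: eqVneq => [->|vy]; last first.
  rewrite add0r -mulrA mulr_suml ler_wpM2l//.
  by apply: ler_sum => u _; apply: IH; exact: ltnW.
rewrite mul1r; apply: le_trans (green_le nb [::] y w0 (pt_ge0 R y) mM).
by rewrite /= pt_id.
Qed.

(** The stopped walks have at most [M] steps, so damping each step by [s] costs at most [s ^+ M]. *)
Lemma hit_weight s M y v : 0 <= s <= 1 ->
  s ^+ M * hit d%:R^-1 M y v <= hit (s / d%:R) M y v.
Proof.
move=> /andP[s0 s1]; elim: M v => [|M IH] v; first by rewrite expr0 mul1r.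
rewrite /=; case: ifP => _; first by rewrite mulr1 exprn_ile1.
rewrite exprS -!mulrA ler_wpM2l// mulrCA ler_wpM2l ?invr_ge0//.
by rewrite mulr_sumr; apply: ler_sum => u _.
Qed.

(** Walks up to the first visit to [y] are continued by walks from [y]; the concatenation determines
    the cutting point, so nothing is counted twice. *)
Lemma green_hit w N m y z v : 0 <= w ->
  hit w m y v * green [::] w N (pt z) y <= green [::] w (N + m) (pt z) v.
Proof.
move=> w0; elim: m v => [|m IH] v; rewrite ?addn0.
  rewrite /= /pt; case: eqVneq => [->|_]; first by rewrite mul1r.
  by rewrite mul0r green_ge0.
rewrite addnS /=; case: eqVneq => [->|_].
  rewrite mul1r -[leRHS]/(green [::] w (N + m).+1 (pt z) y).
  by apply: green_le => //; lia.
rewrite -mulrA mulr_suml; apply: (@le_trans _ _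
  (w * \sum_(u <- nb v) green [::] w (N + m) (pt z) u)).
  by rewrite ler_wpM2l//; apply: ler_sum.
by rewrite lerDr pt_ge0.
Qed.

Lemma green_block w M N x C s : 0 <= w -> w * d%:R = s -> 0 <= C ->
  (forall v, green [::] w N (pt x) v <= C) ->
  forall v, green [::] w (N + M.+1) (pt x) v <=
    green [::] w M (pt x) v + s ^+ M.+1 * C.
Proof.
move=> w0 ws C0 hN; have wC v c : w * \sum_(u <- nb v) c = s * c.
  rewrite big_const_seq count_predT nb_size iter_addr_0 -[c *+ _]mulr_natl.
  by rewrite mulrA ws.
elim: M => [|M IH] v; rewrite addnS greenS.
  rewrite addn0 [green _ _ 0 _ _]/= addr0 lerD2l expr1 -(wC v) ler_wpM2l//.
  by apply: ler_sum => u _.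
rewrite greenS -addrA lerD2l exprS -mulrA -(wC v) -mulrDr ler_wpM2l//.
by rewrite -big_split; apply: ler_sum => u _; exact: IH.
Qed.

(* The steps are cut into blocks of length [M + 1], on each of which the killed
   walk loses at least a third of its mass. *)
Lemma green_killed w M U x : 0 <= w ->
  (w * d%:R) ^+ M.+1 <= 2 / 3 ->
  (forall v, green [::] w M (pt x) v <= U) ->
  forall N v, green [::] w N (pt x) v <= 3 * U.
Proof.
move=> w0 wM hU.
have U0 : 0 <= U by apply: le_trans (hU x); exact: green_ge0.
elim/ltn_ind=> N IH v; case: (leqP N M) => NM.
  apply: (le_trans (green_le nb [::] v w0 (pt_ge0 R x) NM)).
  by have := hU v; lra.
rewrite -(subnK NM); have NN : (N - M.+1 < N)%N by lia.
have := @green_block w M (N - M.+1) x (3 * U) _ w0 erefl _ (IH _ NN) v.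
by move=> /(_ ltac:(lra)); have := hU v; nra.
Qed.

End Hitting.

(** * Exponential growth rates and Fekete's lemma *)

Lemma expr_large (R : realType) (q B : R) : 1 < q ->
  exists N, forall n, (N <= n)%N -> B <= q ^+ n.
Proof.
move=> q1; have q0 : 0 < q - 1 by rewrite subr_gt0.
have bern n : 1 + n%:R * (q - 1) <= q ^+ n.
  elim: n => [|n IH]; first by rewrite mul0r addr0.
  rewrite exprS -natr1; have := ler_wpM2l (ltW (lt_trans ltr01 q1)) IH.
  by have := mulr_ge0 (ler0n R n) (sqr_ge0 (q - 1)); nra.
exists (Num.bound (`|B| / (q - 1))) => n Nn; apply: le_trans (bern n).
have : `|B| / (q - 1) < n%:R.
  apply: (lt_le_trans (archi_boundP _)); first by rewrite divr_ge0// ltW.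
  by rewrite ler_nat.
by rewrite ltr_pdivrMr//; have := ler_norm B; lra.
Qed.

Lemma expr_le_ratio (R : realType) (a b c C : R) : 0 <= a -> 0 < b -> 0 < c ->
  (forall k, c * a ^+ k <= C * b ^+ k) -> a <= b.
Proof.
move=> a0 b0 c0 h; rewrite leNgt; apply/negP => ba.
have [|N hN] := @expr_large R (a / b) ((C + 1) / c);
  first by rewrite ltr_pdivlMr ?mul1r.
have := h N; have := hN N (leqnn _).
rewrite ler_pdivrMr// expr_div_n mulrAC ler_pdivlMr ?exprn_gt0// => h1 h2.
have := le_trans h1 (le_trans _ h2); rewrite (mulrC c) => /(_ (lexx _)).
by rewrite ler_pM2r ?exprn_gt0//; lra.
Qed.

Section Fekete.
Variables (R : realType) (s : nat -> R).
Hypotheses (s_ge1 : forall n, 1 <= s n)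
  (s_mul : forall m n, s (m + n)%N <= s m * s n).

Let s_ge0 n : 0 <= s n. Proof. exact: le_trans (s_ge1 n). Qed.

Let s_pow m q : s (q * m)%N <= s 0 * s m ^+ q.
Proof.
elim: q => [|q IH]; first by rewrite mulr1.
rewrite mulSn exprS mulrCA; apply: (le_trans (s_mul _ _)).
by rewrite ler_wpM2l.
Qed.

Let roots : set R := [set s n `^ n%:R^-1 | n in [set n | (0 < n)%N]].

Let root_pow n : (0 < n)%N -> (s n `^ n%:R^-1) ^+ n = s n.
Proof.
move=> n0; rewrite -powR_mulrn ?powR_ge0// -powRrM mulVf ?powRr1//.
by rewrite pnatr_eq0 -lt0n.
Qed.

(** The limit is the infimum of the roots. The two exponential bounds are recorded with it, since
    later growth arguments use these. *)
Lemma fekete : exists L : R, [/\ 1 <= L,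
  (s n `^ n%:R^-1) @[n --> \oo] --> L, forall n, L ^+ n <= s n
  & forall rho, L < rho -> exists B, 0 < B /\ forall n, s n <= B * rho ^+ n].
Proof.
have roots_ge1 x : roots x -> 1 <= x.
  move=> [n /= n0 <-]; rewrite -[leLHS](_ : 1 `^ n%:R^-1 = 1);
    last by rewrite powR1.
  by rewrite ge0_ler_powR ?nnegrE.
have lb1 : lbound roots 1 by exact: roots_ge1.
have inf_roots : has_inf roots.
  by split; [exists (s 1 `^ 1%:R^-1), 1%N|exists 1].
exists (inf roots); have L1 : 1 <= inf roots by apply: lb_le_inf;
  first exact: inf_roots.1.
have Ln n : (inf roots) ^+ n <= s n.
  case: n => [|n]; first by rewrite expr0.
  rewrite -[leRHS]root_pow//; apply: lerXn2r; rewrite ?nnegrE ?powR_ge0//.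
    exact: le_trans L1.
  by apply: ge_inf; [exact: inf_roots.2|exists n.+1].
(* Some [m] has its root below [rho]; dividing [n] by [m] leaves a bounded remainder, absorbed in
   [B]. *)
have ub rho : inf roots < rho -> exists B, 0 < B /\ forall n, s n <=
  B * rho ^+ n.
  move=> Lrho; have [_ [m /= m0 <-] mrho] := inf_lt inf_roots.1 Lrho.
  have rho1 : 1 <= rho by apply: le_trans (ltW Lrho).
  have smrho : s m <= rho ^+ m.
    rewrite -(root_pow m0); apply: lerXn2r; rewrite ?nnegrE ?powR_ge0//.
    - exact: le_trans rho1.
    - exact: ltW.
  exists (s 0 * (s 0 * s 1 ^+ m)); split.
    by rewrite !mulr_gt0 ?exprn_gt0// (lt_le_trans ltr01).
  move=> n; rewrite {1}(divn_eq n m); apply: (le_trans (s_mul _ _)).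
  have -> : s 0 * (s 0 * s 1 ^+ m) * rho ^+ n =
    (s 0 * s 1 ^+ m) * (s 0 * rho ^+ n) by ring.
  rewrite [leLHS]mulrC; apply: ler_pM => //.
    apply: (@le_trans _ _ (s 0 * s 1 ^+ (n %% m))).
      by have := s_pow 1 (n %% m); rewrite muln1.
    by rewrite ler_wpM2l// ler_weXn2l// ltnW// ltn_pmod.
  apply: (le_trans (s_pow _ _)); rewrite ler_wpM2l//.
  apply: (@le_trans _ _ (rho ^+ m ^+ (n %/ m))).
    by apply: lerXn2r; rewrite ?nnegrE// exprn_ge0// (le_trans ler01).
  by rewrite -exprM ler_weXn2l// mulnC leq_trunc_div.
split => //.
apply/cvgrPdist_le => e e0.
(* Half of [e] is kept so that the ratio [(inf roots + e) / rho] exceeds 1 and its powers beat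
   [B]. *)
pose rho := inf roots + e / 2.
have Lrho : inf roots < rho by rewrite ltrDl divr_gt0.
have rhoe : 1 < (inf roots + e) / rho.
  by rewrite ltr_pdivlMr ?mul1r ?ltrD2l ?(lt_trans _ Lrho) ?(lt_le_trans _
    L1)// /rho; lra.
have [B [B0 hB]] := ub rho Lrho.
have rho0 : 0 < rho by exact: lt_trans (lt_le_trans ltr01 L1) Lrho.
have [N hN] := expr_large B rhoe.
near=> n.
have n0 : (0 < n)%N by near: n; exists 1%N.
have Nn : (N <= n)%N by near: n; exists N.
have le1 : inf roots <= s n `^ n%:R^-1.
  by apply: ge_inf; [exact: inf_roots.2|exists n].
have le2 : s n `^ n%:R^-1 <= inf roots + e.
  have e1 : 0 <= inf roots + e by lra.
  rewrite -(@ler_pXn2r _ n)// ?nnegrE ?powR_ge0// root_pow//.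
  apply: (le_trans (hB n)); have := hN n Nn; rewrite expr_div_n.
  by rewrite ler_pdivlMr ?exprn_gt0.
by rewrite distrC ger0_norm ?subr_ge0//; lra.
Unshelve. all: by end_near.
Qed.

End Fekete.

(** * Counting self-avoiding walks and circuits *)

Section Counting.
Variables (V : choiceType) (adj : rel V) (nb : V -> seq V) (d : nat).
Hypotheses (adj_sym : symmetric adj) (adj_irr : irreflexive adj)
  (nb_uniq : forall x, uniq (nb x))
  (mem_nb : forall x y, (y \in nb x) = adj x y)
  (nb_size : forall x, size (nb x) = d).

Local Notation saw := (saw nb).

Lemma size_sawS A n x :
  size (saw A n.+1 x) = (\sum_(y <- nb x | y \notin x :: A) size (saw (x ::
    A) n y))%N.
Proof.
rewrite [saw _ _ _]/= size_flatten /shape -map_comp sumnE big_map big_filter.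
by apply: eq_bigr => y _; rewrite /= size_map.
Qed.

Lemma size_saw_sub A B n x : {subset B <= A} ->
  (size (saw A n x) <= size (saw B n x))%N.
Proof.
move=> BA; apply: uniq_leq_size; first exact: saw_uniq.
move=> p; rewrite !(mem_saw mem_nb) => /and4P[-> -> -> /hasPn pA] /=.
by apply/hasPn => z /pA; apply: contra; exact: BA.
Qed.

Lemma size_saw_aut n (phi : V -> V) x : bijective phi ->
  (forall x y, adj (phi x) (phi y) = adj x y) ->
  size (saw [::] n (phi x)) = size (saw [::] n x).
Proof.
move=> [psi phiK psiK] hphi; rewrite -[RHS](size_map (map phi)).
have phi_inj := can_inj phiK.
apply: perm_size; apply: uniq_perm; first exact: saw_uniq.
  by rewrite map_inj_uniq ?saw_uniq//; exact: inj_map.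
have pathE u p : path adj (phi u) (map phi p) = path adj u p.
  by elim: p u => //= z p IH u; rewrite hphi IH.
have E q : (map phi q \in saw [::] n (phi x)) = (q \in saw [::] n x).
  rewrite !(mem_saw mem_nb) size_map pathE -map_cons map_inj_uniq//.
  have has0 (r : seq V) : has (mem [::]) r = false.
    by apply/negbTE/hasPn.
  by rewrite !has0.
move=> p; have pE : p = map phi (map psi p).
  by rewrite -map_comp -[LHS]map_id; apply: eq_map => z /=; rewrite psiK.
rewrite {1}pE E; apply/idP/mapP => [psip|[q qx ->]].
  by exists (map psi p).
by rewrite -map_comp (eq_map (g := id)) ?map_id// => z /=; rewrite phiK.
Qed.

(* [Q] is a property of the past [A] and the current vertex [x] that persists
   along the walk. *)
Lemma size_saw_mul (Q : seq V -> V -> Prop) K l n A x :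
  (forall A x y, Q A x -> adj x y -> Q (x :: A) y) ->
  (forall A x, Q A x -> (size (saw A l x) <= K)%N) -> Q A x ->
  (size (saw A (n + l) x) <= size (saw A n x) * K)%N.
Proof.
move=> Qstep QK; elim: n A x => [|n IH] A x QA; first by rewrite mul1n QK.
rewrite addSn !size_sawS big_distrl /= big_seq_cond [leqRHS]big_seq_cond.
apply: leq_sum => y /andP[]; rewrite mem_nb => xy _.
by apply: IH; exact: Qstep xy.
Qed.

Lemma count_nb_avoid A x x' : x' \in A -> adj x' x ->
  (count (fun y => y \notin x :: A) (nb x) <= d.-1)%N.
Proof.
move=> x'A xx'; rewrite -(nb_size x) (perm_size (perm_to_rem (_ :
  x' \in nb x))).
  rewrite (seq.permP (perm_to_rem (_ : x' \in nb x))) /=.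
    by rewrite inE x'A orbT /= add0n count_size.
  by rewrite mem_nb adj_sym.
by rewrite mem_nb adj_sym.
Qed.

Lemma count_nb_avoid2 A x x' y : x' \in A -> adj x' x -> y \in A -> adj x y ->
  y != x' -> (count (fun y => y \notin x :: A) (nb x) <= d.-2)%N.
Proof.
move=> x'A xx' yA xy yx'.
have x'nb : x' \in nb x by rewrite mem_nb adj_sym.
have ynb : y \in rem x' (nb x) by rewrite mem_rem_uniq// inE yx' mem_nb.
rewrite -(nb_size x) (perm_size (perm_to_rem x'nb)).
rewrite (seq.permP (perm_to_rem x'nb)) /= (perm_size (perm_to_rem ynb)).
rewrite (seq.permP (perm_to_rem ynb)) /= !inE x'A yA !orbT /= !add0n.
exact: count_size.
Qed.

Lemma size_saw_avoid A n x x' : x' \in A -> adj x' x ->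
  (size (saw A n x) <= d.-1 ^ n)%N.
Proof.
elim: n A x x' => [|n IH] A x x' x'A xx' //; rewrite size_sawS.
apply: (@leq_trans (\sum_(y <- nb x | y \notin x :: A) d.-1 ^ n)%N).
  rewrite big_seq_cond [leqRHS]big_seq_cond.
  apply: leq_sum => y /andP[]; rewrite mem_nb => xy _.
  by apply: (IH _ _ x) => //; exact: mem_head.
rewrite big_const_seq iter_addn_0 expnSr leq_mul2l.
by rewrite (count_nb_avoid x'A xx') orbT.
Qed.

Fixpoint nonbacktracking x' x (r : seq V) : bool :=
  if r is y :: r' then (y != x') && nonbacktracking x y r' else true.

(* A nonbacktracking path that returns to its past spoils one of the [d.-1 ^ n]
   possible extensions. *)
Lemma size_saw_avoid_lt A x x' r : x' \in A -> adj x' x -> path adj x r ->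
  nonbacktracking x' x r -> has (mem (x :: A)) r -> (1 < d)%N ->
  (size (saw A (size r) x) < d.-1 ^ size r)%N.
Proof.
move=> + + + + + d1; elim: r A x x' => [|y r IH] A x x' // x'A xx'.
rewrite [path _ _ _]/= [nonbacktracking _ _ _]/= [has _ _]/= -/(x :: A).
move=> /andP[xy yr] /andP[yx' nbr] hit.
have Ppos m : (0 < d.-1 ^ m)%N by rewrite expn_gt0; case: d d1 => [|[|]].
rewrite [size (_ :: _)]/= size_sawS; case: (boolP (y \in x :: A)) => yA.
  (* If [y] was visited before, [x'] and [y] are two forbidden neighbours and one choice is lost at
     this step. *)
  have {}yA : y \in A.
    by move: yA; rewrite inE => /predU1P[yx|//]; rewrite yx adj_irr in xy.
  apply: (@leq_ltn_trans (\sum_(y <- nb x | y \notin x :: A) d.-1 ^ size r)%N).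
    rewrite big_seq_cond [leqRHS]big_seq_cond.
    apply: leq_sum => z /andP[]; rewrite mem_nb => xz _.
    by apply: (@size_saw_avoid _ _ _ x) => //; exact: mem_head.
  rewrite big_const_seq iter_addn_0 expnSr ltn_mul2l Ppos /=.
  apply: (leq_ltn_trans (count_nb_avoid2 x'A xx' yA xy yx')).
  by case: d d1 => [|[|]].
have {}hit : has (mem (y :: x :: A)) r.
  move: hit; rewrite /= (negbTE yA) /= => /hasP[z zr zA]; apply/hasP.
  by exists z => //; rewrite /= inE; move: zA => /= ->; rewrite orbT.
(* Otherwise the branch through [y] is strictly smaller by induction, and the other branches obey
   the general bound. *)
have IHy := IH (x :: A) y x (mem_head _ _) xy yr nbr hit.
have ynb : y \in nb x by rewrite mem_nb.
have c1 := count_nb_avoid x'A xx'.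
rewrite (big_rem y)//= yA expnSr.
apply: (@leq_trans (\sum_(z <- nb x | z \notin x :: A) d.-1 ^ size r)%N).
  rewrite [leqRHS](big_rem y)//= yA -addSn; apply: leq_add => //.
  rewrite big_seq_cond [leqRHS]big_seq_cond.
  apply: leq_sum => z /andP[/mem_rem]; rewrite mem_nb => xz _.
  by apply: (@size_saw_avoid _ _ _ x) => //; exact: mem_head.
by rewrite big_const_seq iter_addn_0 leq_mul2l c1 orbT.
Qed.

Lemma nonbacktracking_uniq x y r : uniq (x :: y :: r) -> nonbacktracking x y r.
Proof.
elim: r x y => [|z r IH] x y //; rewrite cons_uniq => /andP[+ u] /=.
by rewrite !inE !negb_or (eq_sym z) => /and3P[_ -> _]; exact: IH.
Qed.

(** The spoiled extension runs once around the circuit and returns to [x]. *)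
Lemma size_saw_circuit c x : (1 < d)%N -> circuit adj c -> x \in c ->
  forall A x', x' \in A -> adj x' x ->
  (size (saw A (size c) x) < d.-1 ^ size c)%N.
Proof.
move=> d1 [/andP[cyc uc] sc] xc A x' x'A xx'.
have [i r cE] := rot_to xc.
have {cyc} cyc : cycle adj (x :: r) by rewrite -cE rot_cycle.
have {uc} uc : uniq (x :: r) by rewrite -cE rot_uniq.
have scr : size c = (size r).+1 by rewrite -(size_rot i) cE.
(* The circuit is reversed if its first step would go back to [x']. *)
rewrite scr in sc *; have : exists2 r', size r' = size r &
    [/\ cycle adj (x :: r'), uniq (x :: r') & head x r' != x'].
  case: (boolP (head x r == x')) => [/eqP hx'|]; last by exists r.
  exists (rev r); rewrite ?size_rev//; split.
  - have := rev_cycle adj (x :: r); rewrite (eq_cycle (e' := adj)) => [E|u v];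
    last first.
      exact: adj_sym.
    by move: cyc; rewrite -E rev_cons -rot1_cons rot_cycle.
  - by move: uc; rewrite /= mem_rev rev_uniq.
  - move: hx' uc sc; case: (lastP r) => // r1 z; rewrite rev_rcons /= => <-.
    case: r1 => [|w r1]//=; rewrite ?size_rcons// => /andP[_].
    by rewrite mem_rcons inE negb_or => /andP[/andP[+ _] _] _; rewrite eq_sym.
case=> -[|y1 [|y2 q]] sq; rewrite -sq in sc * => // -[cy u y1x'].
have -> : (size [:: y1, y2 & q]).+1 = size (y1 :: y2 ::
  rcons q x) by rewrite /= size_rcons.
apply: (@size_saw_avoid_lt A x x') => //.
  rewrite /= in y1x'; rewrite [nonbacktracking _ _ _]/= y1x'.
  move: u; rewrite /= !inE !negb_or => /and3P[/and3P[xy1 xy2 xq] /andP[y12 y1q]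
    /andP[y2q uq]].
  rewrite eq_sym xy2; apply: nonbacktracking_uniq.
  rewrite /= !inE !mem_rcons !inE !negb_or rcons_uniq y12 y1q y2q xq uq.
  by rewrite !(eq_sym _ x) xy1 xy2.
by apply/hasP; exists x; [rewrite !inE mem_rcons mem_head !orbT|exact:
  mem_head].
Qed.

End Counting.

(** * Spheres in the absence of short circuits *)

Section Circuits.
Variables (R : realType) (V : choiceType) (adj : rel V) (nb : V -> seq V).
Variable d : nat.
Hypotheses (adj_sym : symmetric adj) (adj_irr : irreflexive adj)
  (nb_uniq : forall x, uniq (nb x))
  (mem_nb : forall x y, (y \in nb x) = adj x y)
  (nb_size : forall x, size (nb x) = d).

Local Notation saw := (saw nb).

(** [saw] builds walks from the front, whereas spheres grow at the far end. *)
Lemma sum_saw_rcons A n x (F : seq V -> R) :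
  \sum_(p <- saw A n.+1 x) F p =
  \sum_(p <- saw A n x) \sum_(y <- nb (last x p) | y \notin A ++ x :: p)
    F (rcons p y).
Proof.
have sumS B m y (G : seq V -> R) : \sum_(p <- saw B m.+1 y) G p =
    \sum_(z <- nb y | z \notin y :: B) \sum_(p <- saw (y :: B) m z) G (z :: p).
  rewrite [saw _ _ _]/= big_flatten big_map big_filter; apply: eq_bigr => z _.
  by rewrite big_map.
elim: n A x F => [|n IH] A x F.
  rewrite sumS /= big_seq1; apply: eq_big => y; last by rewrite big_seq1.
  by rewrite mem_cat !inE orbC.
rewrite sumS [RHS]sumS; apply: eq_bigr => y _; rewrite IH.
apply: eq_bigr => p _; apply: eq_bigl => z.
by rewrite !(mem_cat, inE) [in LHS]orbAC orbA -!orbA; do !case: (_ \in _);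
  rewrite /= ?orbT.
Qed.

(** The part of the walk from [y] on closes up to a circuit, unless it consists of a single edge,
    which is then retraced. *)
Lemma circuit_of_back_edge x p y : path adj x p -> uniq (x :: p) ->
  adj (last x p) y -> y \in x :: p ->
  (exists p1 z, p = rcons p1 z /\ y = last x p1) \/
  exists c, circuit adj c /\ (size c <= (size p).+1)%N.
Proof.
move=> + + + /splitPl yp; case: yp => p1 p2 yE.
rewrite cat_path last_cat yE => /andP[xp1 yp2] u ly.
case: p2 yp2 u ly => [|z [|w p2]] yp2 u ly.
- by rewrite /= adj_irr in ly.
- by left; exists p1, z; rewrite cats1.
- right; exists [:: y, z, w & p2]; split;
  last by rewrite size_cat /= !addnS !ltnS leq_addl.
  split=> //; apply/andP; split.
    rewrite (_ : cycle adj _ = path adj y (rcons [:: z, w & p2] y))//.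
    by rewrite rcons_path yp2.
  move: u; rewrite -cat_cons cat_uniq => /and3P[_ /hasPn h up2].
  rewrite cons_uniq up2 andbT.
  by apply/negP => yz; have := h _ yz; rewrite /= -yE mem_last.
Qed.

Definition no_circuit_upto m := forall c, circuit adj c -> (m < size c)%N.

(** [last x' (belast x p)] is the predecessor of the endpoint, equal to [x'] when [p] is empty. It
    is the only visited neighbour, as another one would close a circuit of length at most
    [n + 2]. *)
Lemma sum_nb_saw x' x n p (F : V -> R) : no_circuit_upto n.+2 -> adj x' x ->
  p \in saw [:: x'] n x ->
  \sum_(y <- nb (last x p) | y \notin [:: x'] ++ x :: p) F y =
  \sum_(y <- nb (last x p)) F y - F (last x' (belast x p)).
Proof.
move=> nc xx'; rewrite (mem_saw mem_nb) => /and4P[/eqP sp xp up hp].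
have Px : path adj x' (x :: p) by rewrite /= xx'.
have Pu : uniq (x' :: x :: p).
  rewrite cons_uniq up andbT inE negb_or; apply/andP; split.
    by apply/eqP => xE; rewrite xE adj_irr in xx'.
  by apply: contra hp => x'p; apply/hasP; exists x' => //=; rewrite inE.
set z := last x' (belast x p).
have pE : x :: p = rcons (belast x p) (last x p) by rewrite lastI.
have zlast : adj z (last x p).
  by move: Px; rewrite pE rcons_path => /andP[_].
have znb : z \in nb (last x p) by rewrite mem_nb adj_sym.
have zin : z \in x' :: x :: p.
  by rewrite pE -rcons_cons mem_rcons inE mem_last orbT.
rewrite [in RHS](bigD1_seq z)//= addrAC subrr add0r.
rewrite big_seq_cond [RHS]big_seq_cond; apply: eq_bigl => y.
case: (boolP (y \in nb (last x p))) => //=; rewrite mem_nb => ly.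
apply/idP/idP => [yp|yz]; first by apply: contra yp => /eqP ->.
apply/negP => yp.
have [] := circuit_of_back_edge Px Pu ly yp.
  move=> [p1 [w [pE' yE]]]; move: pE'; rewrite pE => /rcons_inj [p1E _].
  by move: yz; rewrite yE /z p1E eqxx.
by move=> [c [/nc cc]]; rewrite /= sp leqNgt cc.
Qed.

Lemma sum_saw_prev x' x n (F : V -> R) : no_circuit_upto n.+2 -> adj x' x ->
  \sum_(p <- saw [:: x'] n.+1 x) F (last x' (belast x p)) =
  (d%:R - 1) * \sum_(p <- saw [:: x'] n x) F (last x p).
Proof.
move=> nc xx'; rewrite sum_saw_rcons mulr_sumr big_seq [RHS]big_seq.
apply: eq_bigr => p px.
under eq_bigr do rewrite belast_rcons /=.
rewrite (sum_nb_saw (fun=> F (last x p)) nc xx' px).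
by rewrite big_const_seq count_predT nb_size iter_addr_0 -mulr_natl; ring.
Qed.

Lemma sum_saw_next x' x n (F : V -> R) : no_circuit_upto n.+2 -> adj x' x ->
  \sum_(p <- saw [:: x'] n.+1 x) F (last x p) =
  \sum_(p <- saw [:: x'] n x) \sum_(y <- nb (last x p)) F y
  - \sum_(p <- saw [:: x'] n x) F (last x' (belast x p)).
Proof.
move=> nc xx'; rewrite sum_saw_rcons -sumrB big_seq [RHS]big_seq.
apply: eq_bigr => p px; rewrite -(sum_nb_saw F nc xx' px).
by apply: eq_bigr => y _; rewrite last_rcons.
Qed.

Lemma size_saw_no_circuit x' x n : no_circuit_upto n.+1 -> adj x' x ->
  (size (saw [:: x'] n x))%:R = (d%:R - 1) ^+ n :> R.
Proof.
elim: n => [|n IH] nc xx' //.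
have sE m : (size (saw [:: x'] m x))%:R = \sum_(p <- saw [:: x'] m x) 1 :> R.
  by rewrite big_const_seq count_predT iter_addr_0.
rewrite sE (sum_saw_prev (fun=> 1))// -sE exprS IH// => c /nc.
exact: ltnW.
Qed.

(** Once the common prefix is removed, the circuit follows [p] up to the first vertex [u] on [q] and
    returns along [q]. *)
Lemma circuit_of_two_paths x p q : path adj x p -> path adj x q ->
  uniq (x :: p) -> uniq (x :: q) -> last x p = last x q -> p != q ->
  exists c, circuit adj c /\ (size c <= size p + size q)%N.
Proof.
elim: p q x => [|y p IH] [|z q] x //.
- by move=> _ _ _ /andP[+ _] /= xl; rewrite xl mem_last.
- by move=> _ _ /andP[+ _] _ /= xl; rewrite -xl mem_last.
move=> xyp xzq up uq lE pq.
have [yz|yz] := eqVneq y z.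
  subst z; move: xyp xzq up uq pq => /= /andP[_ yp] /andP[_ yq].
  rewrite !inE !negb_or -!andbA => /and4P[_ _ yNp up] /and4P[_ _ yNq uq].
  rewrite eqseq_cons eqxx /= => pq.
  have uyp : uniq (y :: p) by rewrite /= yNp.
  have uyq : uniq (y :: q) by rewrite /= yNq.
  have [c [cc sc]] := IH q y yp yq uyp uyq lE pq.
  by exists c; split=> //; lia.
have hPQ : has (mem (z :: q)) (y :: p).
  apply/hasP; exists (last x (y :: p)); [exact: (mem_last y p)|].
  by rewrite lE; exact: (mem_last z q).
have [u [p1 [p2 [PE uQ hp1]]]] : exists u p1 p2,
    [/\ y :: p = rcons p1 u ++ p2, u \in z :: q & ~~ has (mem (z :: q)) p1].
  by case: (split_find hPQ) => u p1 p2 /= uQ hp1; exists u, p1, p2.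
have [q1 [q2 QE]] : exists q1 q2, z :: q = rcons q1 u ++ q2.
  by case: (path.splitP uQ) => q1 q2; exists q1, q2.
exists (x :: rcons p1 u ++ rev q1); split; last first.
  have := congr1 size PE; have := congr1 size QE.
  rewrite /= !size_cat !size_rcons size_rev => -> ->; lia.
have xq : x \notin rcons q1 u.
  by move: uq; rewrite QE /= mem_cat negb_or => /andP[/andP[]].
move: xyp up; rewrite PE cat_path cons_uniq mem_cat negb_or cat_uniq.
move=> /andP[xp1 _] /and3P[/andP[xp _] up _].
move: xzq uq; rewrite QE cat_path cons_uniq cat_uniq.
move=> /andP[xq1 _] /and3P[_ uq _].
split; last first.
  rewrite /= size_cat size_rcons size_rev;
    case: p1 q1 PE QE {xp1 xp up xq xq1 uq hp1} => [|? ?] [|? ?]//=.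
  by case=> yu _ [zu _]; rewrite yu zu eqxx in yz.
apply/andP; split.
  rewrite (_ : cycle adj _ = path adj x (rcons (rcons p1 u ++ rev q1) x))//.
  rewrite rcons_cat cat_path xp1 last_rcons /=.
  have := rev_path adj x (rcons q1 u).
  rewrite last_rcons belast_rcons rev_cons (eq_path (e' := adj)) => [->//|a b].
  exact: adj_sym.
rewrite cons_uniq mem_cat mem_rev negb_or xp cat_uniq rev_uniq up.
move: xq; rewrite mem_rcons inE negb_or => /andP[_ ->] /=.
move: uq; rewrite rcons_uniq => /andP[uq1 ->]; rewrite andbT.
apply/hasPn => v; rewrite mem_rev => vq1; rewrite /= mem_rcons inE negb_or.
apply/andP; split; first by apply: contra uq1 => /eqP <-.
apply: contra hp1 => vp1; apply/hasP; exists v => //=.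
by rewrite QE mem_cat mem_rcons inE vq1 orbT.
Qed.

End Circuits.

(** * Loops in the presence of a spectral gap *)

Section SpectralGap.
Variables (R : realType) (V : choiceType) (adj : rel V) (nb : V -> seq V).
Variable d : nat.
Hypotheses (adj_sym : symmetric adj) (adj_irr : irreflexive adj)
  (nb_uniq : forall x, uniq (nb x))
  (mem_nb : forall x y, (y \in nb x) = adj x y)
  (nb_size : forall x, size (nb x) = d) (d_gt2 : (2 < d)%N).

Local Notation pt := (@pt R V).
Local Notation green := (@green R V nb).
Local Notation avg := (@avg R V nb d).
Local Notation saw := (saw nb).

Let d_gt0 : (0 < d)%N. Proof. exact: ltn_trans d_gt2. Qed.
Let dV_ge0 : 0 <= d%:R^-1 :> R. Proof. by rewrite invr_ge0 ler0n. Qed.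

Variable lam : R.
Hypotheses (lam_gt0 : 0 < lam)
  (gap : forall F f, uniq F -> supp f F ->
    lam * \sum_(x <- F) f x ^+ 2 <= \sum_(x <- F) f x * (f x - avg f x)).

(* With [g] the Green function, [lam |g|^2 <= <g, (I - P) g> <= g(x) <= |g|]. *)
Lemma green_ell2 N x F : uniq F ->
  \sum_(v <- F) green [::] d%:R^-1 N (pt x) v ^+ 2 <= lam ^- 2.
Proof.
set g := green _ _ _ _ => uF.
have ptx : supp (pt x) [:: x].
  by move=> v; rewrite inE /pt => /negbTE ->.
have [F' [uF' xF' hF']] := supp_iter d adj_sym mem_nb N.+1 ptx.
have {}xF' : x \in F' by apply: xF'; rewrite mem_head.
have gF' : supp g F'.
  move=> v vF'; rewrite /g green_iter big_nat big1// => n /andP[_ nN].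
  by apply: hF' => //; exact: ltnW.
have g2F' : supp (fun v => g v ^+ 2) F'.
  by move=> v /gF' ->; rewrite expr0n.
apply: (@le_trans _ _ (\sum_(v <- F') g v ^+ 2)).
  rewrite (sum_supp uF uF' g2F'); apply: ler_sum => v _.
  by rewrite ler_piMl ?sqr_ge0// lern1 leq_b1.
set Q := \sum_(v <- F') _.
have g0 v : 0 <= g v by apply: green_ge0 => //; exact: pt_ge0.
have it0 n v : 0 <= iter n avg (pt x) v.
  by elim: n v => [|n IH] v; [exact: pt_ge0|exact: avg_ge0].
(* [(I - P) g] telescopes, up to a nonnegative remainder that may be dropped. *)
have gavg v : g v - avg g v = pt x v - iter N.+1 avg (pt x) v.
  have := green_nil_avgS nb d N (pt x) v; rewrite -/g.
  rewrite !green_iter big_nat_recr//= -(green_iter nb d N (pt x) v) -/g.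
  by lra.
have Qg : lam * Q <= g x.
  apply: (le_trans (gap uF' gF')).
  rewrite -[leRHS](sum_pt g uF' xF'); apply: ler_sum => v _.
  by rewrite gavg mulrC ler_wpM2r// gerBl.
have gQ : g x ^+ 2 <= Q.
  by rewrite /Q (bigD1_seq x)//= lerDl sumr_ge0// => v _; exact: sqr_ge0.
have Q0 : 0 <= Q by apply: le_trans gQ; exact: sqr_ge0.
have [->|Qpos] := eqVneq Q 0; first by rewrite invr_ge0 exprn_ge0// ltW.
have {}Q0 : 0 < Q by rewrite lt_def Qpos.
rewrite -[leRHS]mul1r ler_pdivlMr ?exprn_gt0//.
rewrite -(ler_pM2l Q0) mulr1; apply: le_trans gQ.
have -> : Q * (Q * lam ^+ 2) = (lam * Q) ^+ 2 by ring.
by rewrite lerXn2r ?nnegrE// mulr_ge0// ltW.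
Qed.

Lemma green_le_gap N x : green [::] d%:R^-1 N (pt x) x <= lam^-1.
Proof.
have := @green_ell2 N x [:: x] isT; rewrite big_seq1 -exprVn.
by rewrite ler_pXn2r ?nnegrE ?invr_ge0 ?(ltW lam_gt0)// green_ge0// => v;
  exact: pt_ge0.
Qed.

(* [S n] sums the killed kernel over the endpoints of the self-avoiding walks of
   length [n], that is, over a sphere of the tree seen from [x] without [x'].
   Subharmonicity makes [q S n - S n.+1] nonincreasing in [n]. *)
Lemma green_loop_le x x' h M Y : adj x' x -> (0 < h)%N ->
  no_circuit_upto adj (h + h) -> 0 < Y ->
    lam ^- 2 <= Y ^+ 2 * (d%:R - 1) ^+ h ->
  green [:: x'] d%:R^-1 M (pt x) x <= d%:R / (d%:R - 1) + Y.
Proof.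
move=> xx' h0 nc Y0 hY; set q : R := d%:R - 1.
have d3 : 3 <= d%:R :> R by rewrite ler_nat.
have q2 : 2 <= q by rewrite /q; lra.
have q0 : 0 < q by lra.
(* [green] accepts a start in its forbidden list, so the value at [x'] is reset to 0 to describe the
   killed walk. *)
pose k v : R := if v == x' then 0 else green [:: x'] d%:R^-1 M (pt x) v.
have gr0 v : 0 <= green [:: x'] d%:R^-1 M (pt x) v.
  by apply: green_ge0 => // y; exact: pt_ge0.
have k0 v : 0 <= k v by rewrite /k; case: ifP.
have kg v : k v <= green [::] d%:R^-1 M (pt x) v.
  rewrite /k; case: ifP => _; last by apply: green_sub => // y; exact: pt_ge0.
  by apply: green_ge0 => // y; exact: pt_ge0.
have kavg v : k v <= pt x v + avg k v.
  rewrite {1}/k; case: ifP => _; first by rewrite addr_ge0 ?pt_ge0 ?avg_ge0.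
  apply: (le_trans (green_leS nb _ _ _ dV_ge0 (pt_ge0 R x))).
  rewrite greenS lerD2l /avg ler_wpM2l// [leLHS]big_mkcond.
  by apply: ler_sum => y _; rewrite inE /k; case: (y == x').
pose S n := \sum_(p <- saw [:: x'] n x) k (last x p).
have kxE : k x = green [:: x'] d%:R^-1 M (pt x) x.
  by rewrite /k; case: eqVneq xx' => // ->; rewrite adj_irr.
rewrite -kxE.
have S0 : S 0%N = k x by rewrite /S /= big_seq1.
have ncm m : (m <= h + h)%N -> no_circuit_upto adj m.
  by move=> mh c /nc; apply: leq_ltn_trans.
have Snext n : (n < h)%N -> d%:R * (S n - \sum_(p <- saw [::
  x'] n x) pt x (last x p))
   <= S n.+1 + \sum_(p <- saw [:: x'] n x) k (last x' (belast x p)).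
  move=> nh; have nc2 : no_circuit_upto adj n.+2.
    by apply: ncm; rewrite -addn1 leq_add.
  rewrite /S (sum_saw_next adj_sym adj_irr nb_uniq mem_nb k nc2 xx') subrK.
  rewrite -sumrB mulr_sumr; apply: ler_sum => p _.
  rewrite -ler_pdivlMl ?ltr0n// -/(avg k _).
  by have := kavg (last x p); rewrite /avg; lra.
(* At the root the predecessor is [x'], where [k] vanishes, and the unit source contributes [d]. *)
have T0 : q * S 0%N - S 1%N <= d%:R - k x.
  have := Snext 0%N h0; rewrite S0 /= !big_seq1 /= pt_id /k eqxx -/(k x).
  by rewrite /q; lra.
have Tn n : (n < h)%N -> q * S n - S n.+1 <= d%:R - k x.
  elim: n => [|n IH] nh //; apply: le_trans (IH (ltnW nh)).
  have := Snext n.+1 nh.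
  rewrite (sum_saw_prev adj_sym adj_irr nb_uniq mem_nb nb_size) //; last first.
    exact: ncm (leq_trans nh (leq_addr _ _)).
  rewrite [X in _ - X]big_seq [X in _ - X]big1 -/(S n) -/q.
    by rewrite /q; lra.
  move=> p; rewrite (mem_saw mem_nb) => /and4P[/eqP sp _ + _].
  case: (lastP p) sp => // p' z _ /andP[+ _]; rewrite mem_rcons last_rcons.
  by rewrite inE negb_or /pt (eq_sym z) => /andP[/negbTE -> _].
(* The recursion [S n.+1 >= q S n - (d - k x)] is solved, multiplied by [q - 1] to avoid a
   division. *)
have Sn n : (n <= h)%N ->
    (q - 1) * q ^+ n * k x - (d%:R - k x) * (q ^+ n - 1) <= (q - 1) * S n.
  elim: n => [|n IH] nh; first by rewrite !expr0 S0; lra.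
  have {}IH := ler_wpM2l (ltW q0) (IH (ltnW nh)).
  have := ler_wpM2l (_ : 0 <= q - 1) (Tn n nh).
  move=> /(_ ltac:(lra)) Tn'; rewrite exprS.
  move: Tn' IH; set a := q ^+ n; set s := S n; set t := S n.+1; nra.
(* Two walks with the same endpoint would close a circuit of length at most [2 h], so the l2 bound
   applies to the sphere; AM-GM against [Y] turns it into a bound on the sum. *)
have Sh : S h <= Y * q ^+ h.
  have uL : uniq [seq last x p | p <- saw [:: x'] h x].
    rewrite map_inj_in_uniq ?saw_uniq// => p r.
    rewrite !(mem_saw mem_nb) => /and4P[/eqP sp xp up _] /and4P[/eqP sr xr ur
      _] lE.
    apply/eqP/negPn/negP => pr.
    have [c [/nc cc]] := circuit_of_two_paths adj_sym xp xr up ur lE pr.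
    by rewrite sp sr leqNgt cc.
  have kQ : \sum_(p <- saw [:: x'] h x) k (last x p) ^+ 2 <= Y ^+ 2 * q ^+ h.
    apply: le_trans hY; rewrite -(big_map (last x) xpredT (fun v => k v ^+ 2)).
    apply: le_trans (green_ell2 M x uL); apply: ler_sum => v _.
    by rewrite lerXn2r ?nnegrE// (le_trans (k0 v)).
  have sz := @size_saw_no_circuit R _ _ _ _ adj_sym adj_irr nb_uniq mem_nb
    nb_size
    x' x h (ncm _ _) xx'.
  rewrite -(ler_pM2l (mulr_gt0 (ltr0n R 2) Y0)).
  have : 2 * Y * S h <= \sum_(p <- saw [::
    x'] h x) (k (last x p) ^+ 2 + Y ^+ 2).
    rewrite mulr_sumr; apply: ler_sum => p _.
    by have := sqr_ge0 (k (last x p) - Y); nra.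
  move=> /le_trans; apply; rewrite big_split /= big_const_seq count_predT.
  rewrite iter_addr_0 -[Y ^+ 2 *+ _]mulr_natr sz;
    last by rewrite -addn1 leq_add2l.
  by rewrite -/q; move: kQ; set a := q ^+ h; set b := bigop _ _ _; nra.
have := Sn h (leqnn _).
have Sh' : (q - 1) * S h <= (q - 1) * (Y * q ^+ h) by rewrite ler_wpM2l//; lra.
move=> /le_trans/(_ Sh').
have qh : 1 <= q ^+ h by rewrite exprn_ege1//; lra.
move: qh; set a := q ^+ h => a1 main.
rewrite leNgt; apply/negP => kbig.
have : d%:R + q * Y < q * k x.
  by move: kbig; rewrite -(ltr_pM2l q0) mulrDr mulrCA mulfV ?mulr1// gt_eqF.
move=> kbig'.
have dE : d%:R = q + 1 :> R by rewrite /q subrK.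
(* By [main] multiplied by [q], the sum of [p1], [p2], [p3] would be at most 0. *)
have p1 : 0 < (q * k x - d%:R - q * Y) * (q * a - 1) by rewrite mulr_gt0//; nra.
have p2 : 0 <= q * Y * (a - 1).
  by rewrite mulr_ge0 ?subr_ge0// mulr_ge0 ?(ltW q0) ?(ltW Y0).
have p3 : 0 < d%:R * (q - 1) by apply: mulr_gt0; lra.
have := ler_wpM2l (ltW q0) main.
by move: p1 p2 p3; rewrite dE; nra.
Qed.

End SpectralGap.

(** * Growth of the number of self-avoiding walks *)

Section Growth.
Variables (R : realType) (s : nat -> R) (L : R).
Hypotheses (s_ge0 : forall n, 0 <= s n) (L_gt0 : 0 < L)
  (s_ub : forall rho, L < rho ->
     exists B, 0 < B /\ forall n, s n <= B * rho ^+ n).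

(** With [rho] midway between [L] and [1 / c], the terms decay geometrically with ratio
    [c rho < 1]. *)
Let tail c : 0 < c -> c * L < 1 -> exists B q, [/\ 0 < B, 0 < q, q < 1 &
  forall m n, \sum_(m <= i < n) c ^+ i * s i <= B * q ^+ m].
Proof.
move=> c0 cL; pose rho := (L + c^-1) / 2.
have Lc : L < c^-1 by rewrite -[ltRHS]mul1r ltr_pdivlMr// mulrC.
have [B [B0 hB]] : exists B, 0 < B /\ forall n, s n <= B * rho ^+ n.
  by apply: s_ub; rewrite /rho; lra.
have rho0 : 0 < rho by rewrite divr_gt0// addr_gt0// invr_gt0.
pose q := c * rho; have q0 : 0 < q by rewrite mulr_gt0.
have q1 : q < 1 by rewrite /q -ltr_pdivlMl// mulr1 /rho; lra.
have p0 : 0 < 1 - q by rewrite subr_gt0.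
exists (B / (1 - q)), q; split => //; first exact: divr_gt0.
move=> m n; have geo : (1 - q) * \sum_(m <= i < n) q ^+ i <= q ^+ m.
  elim: n => [|n IH]; first by rewrite big_geq// mulr0 exprn_ge0// ltW.
  have [mn|nm] := leqP m n; last first.
    by rewrite big_geq// mulr0 exprn_ge0// ltW.
  suff : (1 - q) * \sum_(m <= i < n) q ^+ i = q ^+ m - q ^+ n.
    move=> E; rewrite big_nat_recr//= mulrDr E.
    by have := mulr_ge0 (ltW q0) (exprn_ge0 n (ltW q0)); lra.
  elim: n {IH} mn => [|n IH] mn.
    by move: mn; rewrite leqn0 => /eqP ->; rewrite big_geq// mulr0 subrr.
  move: mn; rewrite leq_eqVlt => /predU1P[->|mn].
    by rewrite big_geq// mulr0 subrr.
  by rewrite big_nat_recr//= mulrDr IH// exprS; ring.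
have le1 : \sum_(m <= i < n) c ^+ i * s i <= B * \sum_(m <= i < n) q ^+ i.
  rewrite mulr_sumr; apply: ler_sum => i _.
  rewrite /q exprMn mulrCA; apply: ler_wpM2l; last exact: hB.
  by rewrite exprn_ge0// ltW.
rewrite mulrAC ler_pdivlMr// mulrC.
apply: (le_trans (ler_wpM2l (ltW p0) le1)).
by rewrite mulrCA ler_wpM2l// ltW.
Qed.

Lemma growth_ge_sum b c : 0 < c -> 0 < b ->
  (forall N, N%:R <= b * \sum_(0 <= m < N) c ^+ m * s m) -> 1 <= c * L.
Proof.
move=> c0 b0 h; rewrite leNgt; apply/negP => cL.
have [B [q [B0 q0 q1 hB]]] := tail c0 cL.
have := archi_boundP (ltW (mulr_gt0 b0 B0)); set N := Num.bound _.
apply/negP; rewrite -leNgt; apply: (le_trans (h N)).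
by rewrite ler_pM2l//; have := hB 0%N N; rewrite mulr1.
Qed.

Lemma growth_ge_tail b c : 0 < c -> 0 < b ->
  (forall r, exists m n, (r <= m)%N /\
     1 <= b * \sum_(m <= i < n) c ^+ i * s i) -> 1 <= c * L.
Proof.
move=> c0 b0 h; rewrite leNgt; apply/negP => cL.
have [B [q [B0 q0 q1 hB]]] := tail c0 cL.
have [|N hN] := @expr_large R q^-1 (b * B + 1); first by rewrite invf_gt1.
have [m [n [Nm h1]]] := h N.
have := hN m Nm; rewrite exprVn -[leRHS]mul1r ler_pdivlMr ?exprn_gt0//.
apply/negP; rewrite -ltNge.
have := le_trans h1 (ler_wpM2l (ltW b0) (hB m n)).
by have := exprn_gt0 m q0; nra.
Qed.

End Growth.

(** * Lower bounds on infinite transitive graphs *)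

Section Transitive.
Variables (R : realType) (V : choiceType) (adj : rel V) (nb : V -> seq V).
Variable d : nat.
Hypotheses (adj_sym : symmetric adj) (adj_irr : irreflexive adj)
  (nb_uniq : forall x, uniq (nb x))
  (mem_nb : forall x y, (y \in nb x) = adj x y)
  (nb_size : forall x, size (nb x) = d) (d_gt0 : (0 < d)%N)
  (V_inf : infinite_set [set: V])
  (conn : graph_connected adj) (trans : vertex_transitive adj).
Variable o : V.

Local Notation pt := (@pt R V).
Local Notation green := (@green R V nb).
Local Notation avg := (@avg R V nb d).
Local Notation saw := (saw nb).
Local Notation s n := ((size (saw [::] n o))%:R : R).

Let dR_gt0 : 0 < d%:R :> R. Proof. by rewrite ltr0n. Qed.
Let dV_ge0 : 0 <= d%:R^-1 :> R. Proof. by rewrite invr_ge0 ler0n. Qed.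

Lemma size_saw_trans n x y : size (saw [::] n x) = size (saw [::] n y).
Proof.
have [phi [[bphi hphi] <-]] := trans x y.
by rewrite (size_saw_aut nb_uniq mem_nb).
Qed.

Lemma green_trans N x y :
  green [::] d%:R^-1 N (pt x) x = green [::] d%:R^-1 N (pt y) y.
Proof.
have [phi [[bphi hphi] <-]] := trans x y.
by rewrite (green_aut R d nb_uniq mem_nb).
Qed.

Lemma size_saw_add m n :
  (size (saw [::] (m + n) o) <= size (saw [::] m o) * size (saw [::] n o))%N.
Proof.
apply: (@size_saw_mul _ _ _ mem_nb (fun _ _ => True)) => // A x _.
by rewrite (size_saw_trans n o x); exact: size_saw_sub.
Qed.

(** Balls are finite and [V] is infinite, so some [z] lies outside the ball of radius [r]; a
    shortest path to it is taken. *)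
Lemma exists_far r : exists z p, [/\ path adj o p, last o p = z,
  (r <= size p)%N & forall q, path adj o q -> last o q = z ->
    (size p <= size q)%N].
Proof.
pose ball := fix ball n := if n is n'.+1 then
  ball n' ++ flatten [seq nb x | x <- ball n'] else [:: o].
have ball_path : forall n p, path adj o p -> (size p <= n)%N ->
  last o p \in ball n.
  elim=> [|n IH] p; first by case: p => // _ _; rewrite /= mem_head.
  case/lastP: p => [_ _|p y]; first by rewrite /= mem_cat (IH [::]).
  rewrite rcons_path size_rcons last_rcons ltnS => /andP[op py] pn.
  rewrite /= mem_cat; apply/orP; right; apply/flattenP.
  by exists (nb (last o p)); rewrite ?mem_nb// map_f// IH.
have [z zr] : exists z, z \notin ball r.
  apply/not_existsP => h; apply: V_inf.
  apply: (@sub_finite_set _ _ [set x | x \in ball r]); last exact: finite_seq.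
  by move=> x _ /=; apply/negPn/negP; exact: h.
pose P n := `[< exists p, [/\ path adj o p, last o p = z & size p = n] >].
have exP : exists n, P n.
  by have [p [op pz]] := conn o z; exists (size p); apply/asboolP; exists p.
case: (ex_minnP exP) => n /asboolP[p [op pz pn]] nmin.
exists z, p; split => //; last first.
  by move=> q oq qz; rewrite pn; apply: nmin; apply/asboolP; exists q.
rewrite leqNgt; apply: contra zr => pr; rewrite -pz.
by apply: ball_path => //; exact: ltnW.
Qed.

Lemma size_saw_gt0 n : (0 < size (saw [::] n o))%N.
Proof.
have [z [p [op pz np pmin]]] := exists_far n.
move: (shortenP op) pz pmin => [q oq uq _ qz] qmin.
have nq : (n <= size q)%N by apply: leq_trans np _; exact: qmin.
case E : (saw [::] n o) => [|//].
suff : take n q \in saw [::] n o by rewrite E.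
rewrite (mem_saw mem_nb) size_takel// eqxx take_path//=.
move: uq => /= /andP[oNq uq]; rewrite take_uniq// andbT.
apply/andP; split; first by apply: contra oNq; exact: mem_take.
exact/hasPn.
Qed.

Variable L : R.
Hypotheses (L_gt0 : 0 < L) (s_ub : forall rho, L < rho ->
     exists B, 0 < B /\ forall n, s n <= B * rho ^+ n).


(** Against the constant function 1 the Green function counts the steps, so loop erasure forces the
    series of [s m * (a / d) ^ m] to diverge. *)
Lemma growth_ge_loops a b : 1 <= a -> 0 < b ->
  (forall x x' M, adj x' x -> green [:: x'] d%:R^-1 M (pt x) x <= a) ->
  (forall M, green [::] d%:R^-1 M (pt o) o <= b) ->
  1 <= a / d%:R * L.
Proof.
move=> a1 b0 ha hb; have a0 : 0 < a by apply: lt_le_trans a1.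
apply: (growth_ge_sum (s := fun n => s n) L_gt0 s_ub (b := b)) => //.
  exact: divr_gt0.
case=> [|N]; first by rewrite big_geq// mulr0.
have g1 : N.+1%:R = green [::] d%:R^-1 N (fun=> 1) o.
  rewrite green_iter (eq_bigr (fun=> 1)).
    by rewrite big_const_nat subn0 iter_addr_0.
  move=> n _; elim: n (o) => [|n IH] v //=.
  rewrite -[RHS](avg_cst nb_size d_gt0 1 v); congr (_ * _).
  by apply: eq_bigr => y _; exact: IH.
rewrite g1; case: N {g1} => [|N].
  rewrite big_nat1 /= addr0 !mul1r mulr1.
  by apply: le_trans (hb 0%N); rewrite /= addr0 pt_id.
apply: (le_trans (green0_le_sawgf mem_nb N dV_ge0 a1 (ltW b0) _ ha hb)) => //.
rewrite sawgfE ler_pM2l// /=; apply: ler_sum => m _.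
by rewrite big_const_seq count_predT iter_addr_0.
Qed.

(* [528 = 198 * 8 / 3]: loops of the damped walk weigh at most [3 * 66 = 198],
   and it reaches each neighbour with probability at least [3 / 8]. *)
Lemma growth_ge_degree : d%:R / 528 <= L.
Proof.
suff : 1 <= 528 / d%:R * L by rewrite mulrAC ler_pdivlMr// mul1r; lra.
have [small|] := pselect (forall M, green [::] d%:R^-1 M (pt o) o <= 64).
  apply: (le_trans (growth_ge_loops (a := 64) (b := 64) _ _ _ small)) => //.
  - lra.
  - move=> x x' M _; apply: (le_trans (green_sub nb (B :=
    [::]) M x dV_ge0 (pt_ge0 R x) _)).
      by [].
    by rewrite (green_trans M x o).
  - by rewrite ler_wpM2r ?(ltW L_gt0)// ler_wpM2r//; lra.
move=> /existsNP big.
have {big} [M [Mbig Mmin]] : exists M, 64 < green [::] d%:R^-1 M (pt o) o /\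
    forall N, 64 < green [::] d%:R^-1 N (pt o) o -> (M <= N)%N.
  have exM : exists M, 64 < green [::] d%:R^-1 M (pt o) o.
    by have [M /negP] := big; rewrite -ltNge; exists M.
  by case: (ex_minnP exM) => M h1 h2; exists M.
have step N : green [::] d%:R^-1 N.+1 (pt o) o <=
  green [::] d%:R^-1 N (pt o) o + 1.
  rewrite !green_iter [leLHS]big_nat_recr//= lerD2l.
  have it1 : forall n v, iter n avg (pt o) v <= 1.
    elim=> [|n IH] v; first by rewrite /= /pt lern1 leq_b1.
    by rewrite -[leRHS](avg_cst nb_size d_gt0 1 v); apply: avg_le.
  exact: (it1 N.+1).
have M0 : (0 < M)%N.
  by case: M Mbig {Mmin} => //; rewrite /= addr0 pt_id; lra.
have Msmall : green [::] d%:R^-1 M (pt o) o <= 65.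
  case: M M0 Mmin {Mbig} => // M _ Mmin; apply: (le_trans (step M)).
  suff : green [::] d%:R^-1 M (pt o) o <= 64 by lra.
  by rewrite leNgt; apply/negP => /Mmin; rewrite ltnn.
(* Positivity holds at odd times; [K] is [M] or [M.+1], and each step adds at most 1, whence
   [64 <= U <= 66]. *)
pose k := M./2; pose K := k.*2.+1.
set g := green [::] d%:R^-1 K.
have [U64 U66] : 64 <= g (pt o) o /\ g (pt o) o <= 66.
  have [KM|KM] : K = M \/ K = M.+1 by rewrite /K /k; lia.
    by rewrite /g KM; split; lra.
  rewrite /g KM; split; last by have := step M; lra.
  by have := green_leS nb [::] M o dV_ge0 (pt_ge0 R o); lra.
set U := g (pt o) o in U64 U66.
have diagU x : g (pt x) x = U by rewrite /g (green_trans K x o).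
have gle x v : g (pt x) v <= U.
  have := green_triangle R adj_sym nb_uniq mem_nb nb_size d_gt0 k x v v.
  by rewrite -/K -/g !diagU; lra.
(* Automorphisms carry the edge from [x] to [y] to an edge at every vertex with the same kernel
   value; the drop is at most [16 <= U / 4]. *)
have edge x y : adj x y -> 3 / 4 * U <= g (pt x) y.
  move=> xy; have /choice[phi hphi] := trans x.
  have := @green_edge_drop R _ _ _ _ adj_sym nb_uniq mem_nb nb_size d_gt0 k U
    (g (pt x) y) (fun v => phi v y) diagU _ _ x.
  suff [h1 h2] : (forall v, adj v (phi v y)) /\
      (forall v, g (pt v) (phi v y) = g (pt x) y).
    by move=> /(_ h1 h2); lra.
  split=> v; have [[bphi aphi] phix] := hphi v.
    by rewrite -{1}phix aphi.
  by rewrite -{1}phix /g (green_aut R d nb_uniq mem_nb).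
(* The damping is chosen so that [t ^+ K.+1 <= 2 / 3], which bounds the loops, while
   [t ^+ K >= 1 / 2], which preserves hitting. *)
pose n := K.+1; pose x : R := (2 * n%:R)^-1.
have n0 : 0 < n%:R :> R by rewrite ltr0n.
have x0 : 0 < x by rewrite invr_gt0 mulr_gt0.
have nx : n%:R * x = 1 / 2 by rewrite /x invfM mulrCA mulfV ?mulr1 ?mul1r//
  gt_eqF.
have x1 : x <= 1 / 2.
  have : 1 <= n%:R :> R by rewrite ler1n.
  by move: nx; nra.
pose t := 1 - x; have t0 : 0 < t by rewrite /t; lra.
have t1 : t <= 1 by rewrite /t; lra.
have tn_ub : t ^+ n <= 2 / 3.
  have := @bernoulli_inv R x n; rewrite nx (ltW x0) /= => /(_ ltac:(lra)).
  by rewrite -/t; lra.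
have tn_lb : 1 / 2 <= t ^+ K.
  have : forall m, 1 - m%:R * x <= t ^+ m.
    elim=> [|m IH]; first by rewrite mul0r subr0.
    rewrite exprS -natr1; have := ler_wpM2l (ltW t0) IH.
    have : 0 <= m%:R * x * x :> R by rewrite !mulr_ge0// ltW.
    by rewrite /t; lra.
  move=> /(_ K); have : n%:R = K%:R + 1 :> R by rewrite natr1.
  by move: nx => + nK; rewrite nK; lra.
pose w := t / d%:R.
have w0 : 0 <= w by rewrite divr_ge0 ?ltW.
have wd : w * d%:R = t by rewrite /w divfK// gt_eqF.
have wle : w <= d%:R^-1 by rewrite -[leRHS]mul1r ler_wpM2r.
have loops M' y : green [::] w M' (pt y) y <= 198.
  apply: (@le_trans _ _ (3 * U)); last by lra.
  apply: (green_killed nb_size (M := K)) => // [|v]; first by rewrite wd.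
  apply: le_trans (gle y v); apply: green_le_weight; last exact: pt_ge0.
  by rewrite w0.
have hits y v : adj v y -> 3 / 8 <= hit nb w K y v.
  move=> vy; have := green_le_hit nb K y v dV_ge0; rewrite -/g diagU.
  have yv : adj y v by rewrite adj_sym.
  move=> /(le_trans (edge y v yv)); rewrite ler_pM2r; last by lra.
  move=> h34; have := hit_weight (s := t) nb d K y v; rewrite -/w (ltW t0) t1.
  move=> /(_ isT); have := hit_ge0 nb K y v dV_ge0.
  by move: tn_lb h34; nra.
have reach p v z : path adj v p -> last v p = z ->
    (3 / 8) ^+ size p <= green [::] w (size p * K) (pt z) v.
  elim: p v => [|y p IH] v; first by move=> _ <-; rewrite /= addr0 pt_id.
  move=> /andP[vy yp] yz; rewrite [size _]/= mulSn addnC exprS.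
  apply: le_trans (green_hit nb _ K y z v w0).
  have c38 : 0 <= 3 / 8 :> R by lra.
  exact: (ler_pM c38 (exprn_ge0 _ c38) (hits _ _ vy) (IH y yp yz)).
have p198 : 0 < 198 :> R by rewrite ltr0n.
have p528 : 0 < 528 / d%:R :> R by apply: divr_gt0; rewrite ltr0n.
apply: (growth_ge_tail (s := fun n => s n) L_gt0 s_ub p528 p198) => r.
have [z [p [op pz rp pmin]]] := exists_far r.
exists (size p), (size p * K).+2; split => //.
have := reach p o z op pz => h1.
have := le_trans h1 (green_leS nb [::] (size p * K) o w0 (pt_ge0 R z)).
have LE := @green0_le_sawgf R _ _ _ mem_nb 198 198 w o (size p * K) (pt z) w0
  _ _ (pt_ge0 R z) _ (fun M' => loops M' o).
move=> /le_trans/(_ (LE _ _ _)) {LE} main.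
have {main} main : (3 / 8) ^+ size p <=
  198 * sawgf nb (198 * w) [::] (size p * K).+1 (pt z) o.
  apply: main; [lra|lra|move=> y y' M' _].
  by apply: le_trans (loops M' y); apply: green_sub => // v; exact: pt_ge0.
have c0 : 0 < (8 / 3 : R) by lra.
have := ler_wpM2l (exprn_ge0 (size p) (ltW c0)) main.
rewrite -exprMn (_ : 8 / 3 * (3 / 8) = 1 :> R); last by field.
rewrite expr1n => /le_trans; apply.
rewrite mulrCA (ler_pM2l p198) sawgfE mulr_sumr.
(* Self-avoiding walks shorter than the distance to [z] cannot end at [z]. *)
rewrite (big_cat_nat (n := size p))//=; last by rewrite 2?leqW// leq_pmulr.
rewrite [X in X + _]big_nat big1 ?add0r => [|m /andP[_ mp]]; last first.
  rewrite big_seq big1 ?mulr0// => q; rewrite (mem_saw mem_nb).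
  move=> /and4P[/eqP qm oq _ _]; rewrite /pt; case: eqP => // qz.
  by have := pmin q oq qz; rewrite qm leqNgt mp.
rewrite big_nat [leRHS]big_nat; apply: ler_sum => m /andP[pm _].
have bigpt : \sum_(q <- saw [::] m o) pt z (last o q) <= s m.
  have -> : s m = \sum_(q <- saw [::] m o) 1.
    by rewrite big_const_seq count_predT iter_addr_0.
  by apply: ler_sum => q _; rewrite /pt lern1 leq_b1.
have w198 : 0 <= 198 * w := mulr_ge0 (ltW p198) w0.
rewrite mulrA; apply: ler_pM bigpt.
- exact: mulr_ge0 (exprn_ge0 _ (ltW c0)) (exprn_ge0 _ w198).
- by apply: sumr_ge0 => q _; exact: pt_ge0.
(* As [size p <= m], the exponent of [8 / 3] may be raised to [m]; the two weights then merge into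
   [(528 / d) ^+ m]. *)
apply: (@le_trans _ _ ((8 / 3) ^+ m * (198 * w) ^+ m)).
  apply: (ler_wpM2r (exprn_ge0 m w198)).
  by apply: ler_weXn2l => //; lra.
rewrite -exprMn; apply: lerXn2r.
- by rewrite nnegrE (mulr_ge0 (ltW c0) w198).
- by rewrite nnegrE (ltW p528).
by move: wle; set dv := d%:R^-1; lra.
Qed.

End Transitive.

(** * The spectral bottom *)

Section UnconditionalSums.
Variables (R : realType) (V : choiceType).
Implicit Types (h : V -> R) (F : seq V).

(** Convergence along the net of finite sets, through which [inner] is compared with finite sums. *)
Definition usum h (a : R) := forall e, 0 < e -> exists F0, forall F,
  uniq F -> {subset F0 <= F} -> `|\sum_(x <- F) h x - a| <= e.

Lemma le_usum h k a b : usum h a -> usum k b ->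
  (forall e F0, 0 < e -> exists F, [/\ uniq F, {subset F0 <= F} &
     \sum_(x <- F) h x <= \sum_(x <- F) k x + e]) -> a <= b.
Proof.
move=> ha kb hk; apply/ler_addgt0Pr => e e0.
have e3 : 0 < e / 3 by rewrite divr_gt0.
have [F1 hF1] := ha _ e3; have [F2 hF2] := kb _ e3.
have [F [uF sF leF]] := hk _ (F1 ++ F2) e3.
have s1 : {subset F1 <= F} by move=> x xF; apply: sF; rewrite mem_cat xF.
have s2 : {subset F2 <= F} by move=> x xF; apply: sF; rewrite mem_cat xF orbT.
have := hF1 F uF s1; have := hF2 F uF s2.
by rewrite !ler_norml => /andP[? ?] /andP[? ?]; lra.
Qed.

Lemma usum_uniq h a b : usum h a -> usum h b -> a = b.
Proof.
move=> ha hb; apply/eqP; rewrite eq_le.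
by apply/andP; split; [apply: (le_usum ha hb)|apply: (le_usum hb ha)];
  move=> e F0 e0; exists (undup F0); rewrite undup_uniq lerDl ltW//;
    split => // x;
  rewrite mem_undup.
Qed.

Lemma usum_supp h F : uniq F -> supp h F -> usum h (\sum_(x <- F) h x).
Proof.
move=> uF hF e e0; exists F => F' uF' sF;
  suff -> : \sum_(x <- F') h x = \sum_(x <- F) h x.
  by rewrite subrr normr0 ltW.
by apply: sum_suppW => //; exact: supp_sub sF hF.
Qed.

Lemma usumB h k a b : usum h a -> usum k b -> usum (fun x => h x - k x) (a - b).
Proof.
move=> ha kb e e0; have e2 : 0 < e / 2 by rewrite divr_gt0.
have [F1 hF1] := ha _ e2; have [F2 hF2] := kb _ e2.
exists (F1 ++ F2) => F uF sF; rewrite sumrB.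
have s1 : {subset F1 <= F} by move=> x xF; apply: sF; rewrite mem_cat xF.
have s2 : {subset F2 <= F} by move=> x xF; apply: sF; rewrite mem_cat xF orbT.
have := hF1 F uF s1; have := hF2 F uF s2.
by rewrite !ler_norml => /andP[? ?] /andP[? ?]; apply/andP; split; lra.
Qed.

Lemma usumZ h a c : usum h a -> usum (fun x => c * h x) (c * a).
Proof.
move=> ha e e0; have c0 : 0 < `|c| + 1 by rewrite ltr_wpDl.
have [F0 hF0] := ha _ (divr_gt0 e0 c0); exists F0 => F uF sF.
rewrite -mulr_sumr -mulrBr normrM.
have := hF0 F uF sF; rewrite ler_pdivlMr//.
by have := normr_ge0 (\sum_(x <- F) h x - a); nra.
Qed.

Lemma ler_sum_sub h F G : uniq F -> uniq G -> {subset F <= G} ->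
  (forall x, 0 <= h x) -> \sum_(x <- F) h x <= \sum_(x <- G) h x.
Proof.
move=> uF uG FG h0; have sub : perm_eq F [seq x <- G | x \in F].
  apply: uniq_perm; rewrite ?filter_uniq// => x; rewrite mem_filter.
  by case: (boolP (x \in F)) => // /FG ->.
rewrite (perm_big _ sub) big_filter [leRHS](bigID (mem F)) /=.
by rewrite lerDl sumr_ge0.
Qed.

Lemma fsets_sum (X : set V) h : finite_set X ->
  (\sum_(x \in X) (h x)%:E)%E = (\sum_(x <- fset_set X) h x)%:E.
Proof. by move=> fX; rewrite fsbig_finite// sumEFin. Qed.

Lemma esum_ge_seq h F : uniq F ->
  ((\sum_(x <- F) h x)%:E <= \esum_(x in [set: V]) (h x)%:E)%E.
Proof.
move=> uF; apply: ereal_sup_ubound; exists [set` F].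
  by split; [exact: finite_seq|].
by rewrite -fsbig_seq// sumEFin.
Qed.

Lemma usum_esum h : (forall x, 0 <= h x) ->
  (\esum_(x in [set: V]) (h x)%:E < +oo)%E ->
  usum h (fine (\esum_(x in [set: V]) (h x)%:E)).
Proof.
move=> h0 fin; set S := esum _ _ in fin *.
have S0 : (0 <= S)%E by apply: esum_ge0 => x _; rewrite lee_fin.
have SE : S = (fine S)%:E by rewrite fineK// ge0_fin_numE.
move=> e e0; have [] := @ub_ereal_sup_adherent R
  [set (\sum_(x \in A) (h x)%:E)%E | A in fsets [set: V]] e e0.
  by rewrite -[ereal_sup _]/S ge0_fin_numE.
move=> _ [X [fX _] <-]; rewrite -[ereal_sup _]/S fsets_sum// SE -EFinB lte_fin
  => ltX.
exists (fset_set X) => F uF sF.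
have leF : \sum_(x <- F) h x <= fine S.
  by rewrite -lee_fin -SE; exact: esum_ge_seq.
have leX : \sum_(x <- fset_set X) h x <= \sum_(x <- F) h x.
  by apply: ler_sum_sub => //; exact: fset_uniq.
by rewrite ler_norml; apply/andP; split; lra.
Qed.

Lemma esum_bounded h B : (forall x, 0 <= h x) ->
  (forall F, uniq F -> \sum_(x <- F) h x <= B) ->
  (\esum_(x in [set: V]) (h x)%:E < +oo)%E.
Proof.
move=> h0 hB; apply: (@le_lt_trans _ _ B%:E); last by rewrite ltry.
apply: ge_ereal_sup => _ [X [fX _] <-].
by rewrite fsets_sum// lee_fin; apply: hB; exact: fset_uniq.
Qed.

(** The bound [B] makes the sums of the positive and negative parts finite, so the extended
    subtraction in [inner] is a real one. *)
Lemma usum_inner (f g : V -> R) B :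
  (forall F, uniq F -> \sum_(x <- F) `|f x * g x| <= B) ->
  usum (fun x => f x * g x) (inner f g).
Proof.
move=> hB; pose h x := f x * g x.
pose hp x := Num.max (h x) 0; pose hn x := Num.max (- h x) 0.
have hp0 x : 0 <= hp x by rewrite le_max lexx orbT.
have hn0 x : 0 <= hn x by rewrite le_max lexx orbT.
have sp : (\esum_(x in [set: V]) (hp x)%:E < +oo)%E.
  apply: (esum_bounded (B := B) hp0) => F uF; apply: le_trans (hB F uF).
  by apply: ler_sum => x _; rewrite /hp ge_max normr_ge0 ler_norm.
have sn : (\esum_(x in [set: V]) (hn x)%:E < +oo)%E.
  apply: (esum_bounded (B := B) hn0) => F uF; apply: le_trans (hB F uF).
  by apply: ler_sum => x _; rewrite /hn ge_max normr_ge0 -normrN ler_norm.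
have hE : h = (fun x => hp x - hn x).
  by apply/funext => x; rewrite /hp /hn; case: ltrP => ?; case: ltrP => ?; lra.
rewrite -/h hE.
suff -> : inner f g = fine (\esum_(x in [set: V]) (hp x)%:E)
    - fine (\esum_(x in [set: V]) (hn x)%:E).
  by apply: usumB; exact: usum_esum.
rewrite /inner -fineB ?ge0_fin_numE ?esum_ge0//; try by move=> x _;
  rewrite lee_fin.
have -> : ((fun x => (f x * g x)%:E) ^\+)%E = (fun x => (hp x)%:E).
  by apply/funext => x; rewrite funeposE /hp EFin_max.
have -> // : ((fun x => (f x * g x)%:E) ^\-)%E = (fun x => (hn x)%:E).
by apply/funext => x; rewrite funenegE /hn EFin_max EFinN.
Qed.

Lemma ell2_bounded (f : V -> R) : ell2 f ->
  exists B, forall F, uniq F -> \sum_(x <- F) f x ^+ 2 <= B.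
Proof.
move=> f2; exists (fine (\esum_(x in [set: V]) (f x ^+ 2)%:E)) => F uF.
have f2' : (\esum_(x in [set: V]) (f x ^+ 2)%:E < +oo)%E.
  move: f2; rewrite /ell2 /summable; congr (_ < _)%E; apply: eq_esum => x _.
  by rewrite gee0_abs// lee_fin sqr_ge0.
rewrite -lee_fin fineK ?esum_ge_seq// ge0_fin_numE//.
by apply: esum_ge0 => x _; rewrite lee_fin sqr_ge0.
Qed.

Lemma bounded_ell2 (f : V -> R) B :
  (forall F, uniq F -> \sum_(x <- F) f x ^+ 2 <= B) -> ell2 f.
Proof.
move=> hB; rewrite /ell2 /summable.
have -> : \esum_(x in [set: V]) `|(f x ^+ 2)%:E|%E = \esum_(x in [set:
  V]) (f x ^+ 2)%:E.
  by apply: eq_esum => x _; rewrite gee0_abs// lee_fin sqr_ge0.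
by apply: (esum_bounded (B := B)) => // x; exact: sqr_ge0.
Qed.

Lemma sum_mul_le (f g : V -> R) F :
  \sum_(x <- F) `|f x * g x| <= \sum_(x <- F) f x ^+ 2 + \sum_(x <- F) g x ^+ 2.
Proof.
rewrite -big_split; apply: ler_sum => x _ /=; rewrite normrM.
rewrite -(real_normK (num_real (f x))) -(real_normK (num_real (g x))).
by have := sqr_ge0 (`|f x| - `|g x|); have := sqr_ge0 `|f x|;
  have := sqr_ge0 `|g x|; nra.
Qed.

End UnconditionalSums.

Lemma card_fset_set_seq (T : choiceType) (A : set T) (t : seq T) :
  uniq t -> (forall x, A x <-> x \in t) -> #|` fset_set A| = size t.
Proof.
move=> ut At; have AE : A = [set` t].
  by apply/seteqP; split=> x /=; rewrite -/(is_true _) => /At.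
apply: perm_size; apply: uniq_perm; rewrite ?fset_uniq// => x.
rewrite in_fset_set; last by rewrite AE; exact: finite_seq.
by apply/idP/idP; rewrite inE => /At.
Qed.

(** * Cheeger's inequality *)

Section Cheeger.
Variables (R : realType) (V : choiceType) (adj : rel V) (nb : V -> seq V).
Variable d : nat.
Hypotheses (adj_sym : symmetric adj) (adj_irr : irreflexive adj)
  (nb_uniq : forall x, uniq (nb x))
  (mem_nb : forall x y, (y \in nb x) = adj x y)
  (nb_size : forall x, size (nb x) = d) (d_gt0 : (0 < d)%N).

Local Notation pt := (@pt R V).
Local Notation avg := (@avg R V nb d).
Local Notation phi := (edge_isoperimetric R adj d).

Let dR_gt0 : 0 < d%:R :> R. Proof. by rewrite ltr0n. Qed.

Let ratios : set R := [set (#|` fset_set (edge_boundary adj W)|)%:R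
   / (d%:R * (#|` fset_set W|)%:R) | W in [set W | finite_set W /\ W !=set0]].

Lemma edge_isoperimetric_ge0 : 0 <= phi.
Proof.
have [|/nonemptyPn r0] := pselect (ratios !=set0).
  by move=> r0; apply: lb_le_inf => // _ [W _ <-]; rewrite divr_ge0// mulr_ge0.
by rewrite /edge_isoperimetric -/ratios r0 inf0.
Qed.

Lemma edge_isoperimetric_le F : uniq F ->
  phi * (d%:R * (size F)%:R) <= \sum_(x <- F) \sum_(y <- nb x | y \notin F) 1.
Proof.
move=> uF; case: (posnP (size F)) => [/size0nil ->|F0].
  by rewrite /= !mulr0 big_nil.
pose bd := [seq (x, y) | x <- F, y <- [seq y <- nb x | y \notin F]].
have bdE : \sum_(x <- F) \sum_(y <- nb x | y \notin F) 1 = (size bd)%:R :> R.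
  rewrite /bd size_allpairs_dep sumnE big_map natr_sum; apply: eq_bigr => x _.
  by rewrite -big_filter big_const_seq count_predT iter_addr_0.
rewrite bdE -ler_pdivlMr ?mulr_gt0 ?ltr0n//.
apply: ge_inf.
  by exists 0 => _ [W _ <-]; rewrite divr_ge0// mulr_ge0.
exists [set` F].
  by split; [exact: finite_seq|case: F F0 {uF bd bdE} => // x F _; exists x;
    rewrite /= mem_head].
rewrite (card_fset_set_seq (t := F))// (card_fset_set_seq (t := bd))//.
  by apply: allpairs_uniq_dep => // [x _|[x y] [x' y'] _ _ /= [-> ->]//];
    rewrite filter_uniq.
move=> [x y]; split=> /= [[xF yF xy]|].
  apply/allpairsPdep; exists x, y; split => //.
  by rewrite mem_filter mem_nb xy andbT; apply/negP.
move=> /allpairsPdep[x' [y' [xF + [-> ->]]]].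
by rewrite mem_filter mem_nb => /andP[/negP yF xy]; split.
Qed.

(* Discrete coarea formula: peel off the minimal value of [q] on its support. *)
Lemma coarea F q : uniq F -> supp q F -> (forall x, 0 <= q x) ->
  phi * (d%:R * \sum_(x <- F) q x) <=
  \sum_(x <- F) \sum_(y <- nb x) Num.max (q x - q y) 0.
Proof.
move: {2}(size F) (leqnn (size F)) => n.
elim: n F q => [|n IH] F q sF uF qF q0.
  by move: sF; rewrite leqn0 => /nilP ->; rewrite !big_nil !mulr0.
have [F0|F0] := eqVneq F [::]; first by rewrite F0 !big_nil !mulr0.
have [x0 x0F x0min] : exists2 x0, x0 \in F & forall x, x \in F -> q x0 <= q x.
  elim: F F0 {sF uF qF} => // x [|y F] IHF _.
    by exists x; rewrite ?mem_head// => z; rewrite inE => /eqP ->.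
  have [z zF zmin] := IHF isT.
  have [xz|zx] := leP (q x) (q z).
    exists x; first exact: mem_head.
    by move=> t; rewrite inE => /predU1P[->//|/zmin]; exact: le_trans.
  exists z; first by rewrite inE zF orbT.
  by move=> t; rewrite inE => /predU1P[->|/zmin//]; exact: ltW.
pose m := q x0; pose q' x := if x \in F then q x - m else 0.
have q'0 x : 0 <= q' x by rewrite /q'; case: ifP => // xF;
  rewrite subr_ge0 x0min.
have pF := perm_to_rem x0F.
have q'F1 : supp q' (rem x0 F).
  move=> x; rewrite mem_rem_uniq// inE negb_and negbK /q'.
  by case/orP => [/eqP ->|/negbTE -> //]; rewrite x0F /m subrr.
have uF1 : uniq (rem x0 F) by exact: rem_uniq.
have sF1 : (size (rem x0 F) <= n)%N by rewrite size_rem// -ltnS prednK// lt0n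
  size_eq0.
have {}IH := IH _ q' sF1 uF1 q'F1 q'0.
have sumF (h : V -> R) : \sum_(x <- F) h x = h x0 + \sum_(x <- rem x0 F) h x.
  by rewrite (perm_big _ pF) big_cons.
have q'x0 : q' x0 = 0 by rewrite /q' x0F /m subrr.
have {}IH : phi * (d%:R * \sum_(x <- F) q' x) <=
    \sum_(x <- F) \sum_(y <- nb x) Num.max (q' x - q' y) 0.
  rewrite !sumF q'x0 add0r; apply: (le_trans IH); rewrite lerDr.
  by apply: sumr_ge0 => y _; rewrite le_max lexx orbT.
have m0 : 0 <= m by exact: q0.
have bd := ler_wpM2l m0 (edge_isoperimetric_le uF).
have sq : \sum_(x <- F) q x = \sum_(x <- F) q' x + (size F)%:R * m.
  rewrite mulr_natl -[_ *+ _]addr0 -iter_addr -(count_predT F) -big_const_seq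
    -big_split.
  by apply: eq_big_seq => x xF; rewrite /= /q' xF subrK.
(* Lowering [q] by [m] on [F] changes only the increments along edges leaving [F], each by [m]. *)
have -> : \sum_(x <- F) \sum_(y <- nb x) Num.max (q x - q y) 0 =
  \sum_(x <- F) \sum_(y <- nb x) Num.max (q' x - q' y) 0 +
  m * \sum_(x <- F) \sum_(y <- nb x | y \notin F) 1.
  rewrite mulr_sumr -big_split; apply: eq_big_seq => x xF /=.
  rewrite mulr_sumr [X in _ = _ + X]big_mkcond -big_split;
    apply: eq_bigr => y _ /=.
  rewrite /q' xF; case: (boolP (y \in F)) => yF /=.
    by rewrite addr0; congr (Num.max _ _); ring.
  by rewrite (qF y yF) !subr0 mulr1 !max_l ?subr_ge0 ?x0min ?q0// subrK.
by rewrite sq; move: IH bd; set A := \sum_(x <- F) q' x; lra.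
Qed.

(* Coarea applied to [f ^+ 2], whose differences are split by AM-GM with weight
   [t = phi / 4]. *)
Lemma cheeger F f : 0 < phi -> uniq F -> supp f F ->
  phi ^+ 2 / 8 * \sum_(x <- F) f x ^+ 2 <= \sum_(x <- F) f x * (f x - avg f x).
Proof.
move=> phi0 uF fF; pose q x := f x ^+ 2.
have qF : supp q F by move=> x /fF; rewrite /q => ->; rewrite expr0n.
have q0 x : 0 <= q x by exact: sqr_ge0.
set Q := \sum_(x <- F) f x ^+ 2; set E := \sum_(x <- F) _.
have co := coarea uF qF q0.
have Pq : \sum_(x <- F) avg q x <= Q by exact: sum_avg_le.
pose t := phi / 4; have t0 : 0 < t by rewrite divr_gt0.
have avgE (h : V -> R) x : \sum_(y <- nb x) h y = d%:R * avg h x.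
  by rewrite /avg mulrA mulfV ?mul1r// gt_eqF.
have le1 x : \sum_(y <- nb x) Num.max (q x - q y) 0 <=
    d%:R * ((t + (2 * t)^-1) * q x + (t +
      (2 * t)^-1) * avg q x - t^-1 * (f x * avg f x)).
  have -> : d%:R * ((t + (2 * t)^-1) * q x + (t +
    (2 * t)^-1) * avg q x - t^-1 * (f x * avg f x))
    = \sum_(y <- nb x) ((t + (2 * t)^-1) * q x + 1 * ((t + (2 * t)^-1) * q y +
      (- (t^-1 * f x)) * f y)).
    rewrite (avgE (fun y => _ * q x + 1 * _)); congr (_ * _).
    have /= -> := avg_lin nb d (t + (2 * t)^-1) 1 (fun=> q x) _ x.
    rewrite avg_cst// avg_lin; ring.
  apply: ler_sum => y _.
  have tV : 0 < t^-1 by rewrite invr_gt0.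
  have -> : (2 * t)^-1 = t^-1 / 2 by rewrite invfM mulrC.
  have sqE : t^-1 * ((f x - f y) - t * (f x + f y)) ^+ 2 =
    t^-1 * (f x - f y) ^+ 2
      - 2 * (f x ^+ 2 - f y ^+ 2) + t * (f x + f y) ^+ 2.
    by field; rewrite gt_eqF.
  have sq1 := mulr_ge0 (ltW tV) (sqr_ge0 ((f x - f y) - t * (f x + f y))).
  rewrite sqE in sq1.
  have sq2 := mulr_ge0 (ltW t0) (sqr_ge0 (f x - f y)).
  have sq3 := mulr_ge0 (ltW tV) (sqr_ge0 (f x - f y)).
  have sq4 := mulr_ge0 (ltW t0) (sqr_ge0 (f x + f y)).
  by rewrite ge_max /q; apply/andP; split; lra.
set c := t + (2 * t)^-1 in le1.
have {le1} le2 : \sum_(x <- F) \sum_(y <- nb x) Num.max (q x - q y) 0 <=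
    d%:R * (c * Q + c * (\sum_(x <- F) avg q x) - t^-1 * \sum_(x <- F) f x *
      avg f x).
  rewrite [c * Q]mulr_sumr [c * bigop _ _ _]mulr_sumr [t^-1 * _]mulr_sumr.
  by rewrite -big_split -sumrB mulr_sumr; apply: ler_sum => x _; exact: le1.
have {le2} := le_trans co le2; rewrite mulrCA ler_pM2l// -/Q.
have EE : E = Q - \sum_(x <- F) f x * avg f x.
  by rewrite /E /Q -sumrB; apply: eq_bigr => x _; rewrite mulrBr expr2.
have -> : \sum_(x <- F) f x * avg f x = Q - E by rewrite EE; ring.
have cV : c = t + t^-1 / 2 by rewrite /c invfM [_ * t^-1]mulrC.
have c0 : 0 <= c by rewrite cV addr_ge0 ?divr_ge0 ?invr_ge0 ?ltW.
have := ler_wpM2l c0 Pq; rewrite cV => cPq main.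
(* With [t = phi / 4] the term in [Q] absorbs half of the left side, which leaves the constant
   [phi ^+ 2 / 8]. *)
have {main} main : phi * Q <= 2 * t * Q + t^-1 * E by move: cPq main; lra.
have := ler_wpM2l (ltW t0) main; rewrite [t * (_ +
  _)]mulrDr [t * (t^-1 * _)]mulrA.
by rewrite mulfV ?gt_eqF// mul1r /t; lra.
Qed.

End Cheeger.

(** * Positivity and attainment of the spectral bottom *)

Section SpectralBottom.
Variables (R : realType) (V : choiceType) (adj : rel V) (nb : V -> seq V).
Variable d : nat.
Hypotheses (adj_sym : symmetric adj) (adj_irr : irreflexive adj)
  (nb_uniq : forall x, uniq (nb x))
  (mem_nb : forall x y, (y \in nb x) = adj x y)
  (nb_size : forall x, size (nb x) = d) (d_gt0 : (0 < d)%N)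
  (degE : forall x, degree adj x = d).

Local Notation pt := (@pt R V).
Local Notation avg := (@avg R V nb d).
Local Notation phi := (edge_isoperimetric R adj d).
Local Notation lam := (spectral_bottom R adj).


Lemma srw_op_avg (f : V -> R) x : srw_op adj f x = avg f x.
Proof.
rewrite /srw_op -(@fsbig_widen _ _ _ _ [set` nb x]) //; last first.
  move=> y [_ /= /negP]; rewrite mem_nb /srw => /negbTE ->.
  by rewrite mul0r mul0r.
rewrite -fsbig_seq// /avg mulr_sumr; apply: eq_big_seq => y.
by rewrite mem_nb /srw degE => ->; rewrite mul1r.
Qed.

Lemma sqr_avg_le (f : V -> R) x : avg f x ^+ 2 <= avg (fun y => f y ^+ 2) x.
Proof.
set m := avg f x; rewrite -subr_ge0.
have -> : avg (fun y => f y ^+ 2) x - m ^+ 2 =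
    avg (fun y => 1 * (1 * f y ^+ 2 + (- (2 * m)) * f y) + 1 * m ^+ 2) x.
  by rewrite !avg_lin avg_cst// -/m; ring.
by apply: avg_ge0 => y; have := sqr_ge0 (f y - m); lra.
Qed.

(** By Jensen's inequality [avg] contracts the l2 norm; on [F] it sees only [F] and its neighbours,
    which form [G], a list chosen before [r]. *)
Lemma sum_sqr_avg_le F : uniq F -> exists G, [/\ uniq G, {subset F <= G} &
  forall r : V -> R, \sum_(x <- F) avg r x ^+ 2 <= \sum_(x <- G) r x ^+ 2].
Proof.
move=> uF; pose G := undup (F ++ flatten [seq nb x | x <- F]).
have uG : uniq G by exact: undup_uniq.
have FG : {subset F <= G} by move=> x xF; rewrite mem_undup mem_cat xF.
exists G; split => // r; pose q x : R := if x \in G then r x ^+ 2 else 0.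
have qG : supp q G by move=> x /negbTE xG; rewrite /q xG.
have q0 x : 0 <= q x by rewrite /q; case: ifP => // _; exact: sqr_ge0.
have -> : \sum_(x <- G) r x ^+ 2 = \sum_(x <- G) q x.
  by apply: eq_big_seq => x xG; rewrite /q xG.
apply: le_trans (sum_avg_le adj_sym nb_uniq mem_nb nb_size d_gt0 uG qG q0).
apply: (@le_trans _ _ (\sum_(x <- F) avg q x)).
  rewrite big_seq [leRHS]big_seq; apply: ler_sum => x xF.
  apply: (le_trans (sqr_avg_le r x)); rewrite /avg ler_wpM2l// big_seq
    [leRHS]big_seq.
  apply: ler_sum => y yx; rewrite /q ifT// mem_undup mem_cat; apply/orP; right.
  by apply/flattenP; exists (nb x); [exact: map_f|].
by apply: ler_sum_sub => // x; exact: avg_ge0.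
Qed.

Lemma supp_ell2 (f : V -> R) F : uniq F -> supp f F -> ell2 f.
Proof.
move=> uF fF; apply: (bounded_ell2 (B := \sum_(x <- F) f x ^+ 2)) => G uG.
rewrite (sum_supp uG uF) => [|x /fF ->]; last by rewrite expr0n.
by apply: ler_sum => x _; rewrite ler_piMl ?sqr_ge0// lern1 leq_b1.
Qed.

Lemma usum_ell2 (f : V -> R) : ell2 f ->
  usum (fun x => f x * f x) (inner f f) /\
  usum (fun x => f x * (f x - avg f x)) (inner f (fun x =>
    f x - srw_op adj f x)).
Proof.
move=> /ell2_bounded[B hB].
have hA F : uniq F -> \sum_(x <- F) avg f x ^+ 2 <= B.
  move=> uF; have [G [uG _ hG]] := sum_sqr_avg_le uF.
  exact: le_trans (hG f) (hB G uG).
split.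
  apply: (usum_inner (B := B + B)) => F uF;
    apply: (le_trans (sum_mul_le _ _ _)).
  by rewrite lerD ?hB.
have -> : (fun x => f x - srw_op adj f x) = (fun x => f x - avg f x).
  by apply/funext => x; rewrite srw_op_avg.
apply: (usum_inner (B := B + (2 * B + 2 * B))) => F uF.
apply: (le_trans (sum_mul_le _ _ _)); rewrite lerD ?hB//.
apply: (@le_trans _ _ (2 * \sum_(x <- F) f x ^+ 2 +
  2 * \sum_(x <- F) avg f x ^+ 2)).
  rewrite !mulr_sumr -big_split; apply: ler_sum => x _ /=.
  by have := sqr_ge0 (f x + avg f x); lra.
by rewrite lerD// ler_pM2l ?hA ?hB.
Qed.

Lemma inner_supp (f : V -> R) F : uniq F -> supp f F ->
  inner f f = \sum_(x <- F) f x ^+ 2 /\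
  inner f (fun x => f x - srw_op adj f x) = \sum_(x <- F) f x * (f x - avg f x).
Proof.
move=> uF fF; have [u1 u2] := usum_ell2 (supp_ell2 uF fF); split.
  apply: (usum_uniq u1); under eq_bigr do rewrite expr2.
  by apply: usum_supp => // x /fF ->; rewrite mul0r.
apply: (usum_uniq u2).
by apply: usum_supp => // x /fF ->; rewrite mul0r.
Qed.

(* Truncating [f] to a finite set [F] creates a cross term between [F] and its
   complement; half of [c] pays for it, up to the small mass of [f] outside
   [F]. *)
Lemma spectral_lower_bounds_half c : 0 < c ->
  (forall F (f : V -> R), uniq F -> supp f F ->
    c * \sum_(x <- F) f x ^+ 2 <= \sum_(x <- F) f x * (f x - avg f x)) ->
  spectral_lower_bounds adj (c / 2).
Proof.
move=> c0 hc f f2; have [u1 u2] := usum_ell2 f2.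
apply: (le_usum (usumZ (c / 2) u1) u2) => e F0 e0.
have ce0 : 0 < c * e by rewrite mulr_gt0.
(* The tolerance [c * e] is what the factor [1 / (2 c)] in [err] turns into [e]. *)
have [F1 hF1] := u1 _ ce0.
pose F := undup (F0 ++ F1); have uF : uniq F by exact: undup_uniq.
have F0F : {subset F0 <= F} by move=> x xF; rewrite mem_undup mem_cat xF.
have F1F : {subset F1 <= F} by move=> x xF; rewrite mem_undup mem_cat xF orbT.
exists F; split => //.
have [G [uG FG hG]] := sum_sqr_avg_le uF.
pose g x := if x \in F then f x else 0; pose r x := if x \in F then 0 else f x.
have gF : supp g F by move=> x /negbTE xF; rewrite /g xF.
have avgf x : avg f x = avg g x + avg r x.
  have := avg_lin nb d 1 1 g r x; rewrite !mul1r => <-; congr (_ * _).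
  by apply: eq_bigr => y _; rewrite !mul1r /g /r; case: ifP;
    rewrite ?addr0 ?add0r.
have hcg := hc F g uF gF.
have tail : \sum_(x <- G) r x ^+ 2 <= 2 * (c * e).
  have sub : perm_eq F [seq x <- G | x \in F].
    apply: uniq_perm; rewrite ?filter_uniq// => x; rewrite mem_filter.
    by case: (boolP (x \in F)) => // /FG ->.
  have E : \sum_(x <- G) f x * f x = \sum_(x <- F) f x * f x +
    \sum_(x <- G) r x ^+ 2.
    rewrite (bigID (mem F)) /= (perm_big _ sub) big_filter; congr (_ + _).
    rewrite [LHS]big_mkcond; apply: eq_bigr => x _; rewrite /r.
    by case: (x \in F); rewrite ?expr0n ?expr2.
  have := hF1 G uG (fun x xF => FG x (F1F x xF)); have := hF1 F uF F1F.
  by rewrite E !ler_norml => /andP[? ?] /andP[? ?]; lra.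
have {}hG := le_trans (hG r) tail.
pose Q := \sum_(x <- F) f x * f x.
have gQ : \sum_(x <- F) g x ^+ 2 = Q.
  by apply: eq_big_seq => x xF; rewrite /g xF expr2.
have gE : \sum_(x <- F) g x * (g x - avg g x) =
    \sum_(x <- F) f x * (f x - avg f x) + \sum_(x <- F) f x * avg r x.
  rewrite -big_split; apply: eq_big_seq => x xF /=.
  by rewrite avgf {1 2}/g xF; ring.
have err : \sum_(x <- F) f x * avg r x <=
  c / 2 * Q + (2 * c)^-1 * \sum_(x <- F) avg r x ^+ 2.
  rewrite /Q !mulr_sumr -big_split; apply: ler_sum => x _ /=.
  have cV : 0 < c^-1 by rewrite invr_gt0.
  have -> : (2 * c)^-1 = c^-1 / 2 by rewrite invfM mulrC.
  have := mulr_ge0 (ltW cV) (sqr_ge0 (c * f x - avg r x)).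
  have -> : c^-1 * (c * f x - avg r x) ^+ 2 =
    c * (f x * f x) - 2 * (f x * avg r x)
     + c^-1 * avg r x ^+ 2 by field; rewrite gt_eqF.
  by lra.
have err2 : (2 * c)^-1 * \sum_(x <- F) avg r x ^+ 2 <= e.
  by rewrite ler_pdivrMl ?mulr_gt0//; lra.
by rewrite -mulr_sumr -/Q; move: hcg; rewrite gQ gE; lra.
Qed.

Hypothesis namen : ~ amenable R adj d.
Variable o : V.

Let phi0 : 0 < phi.
Proof. by rewrite lt_def edge_isoperimetric_ge0 andbT; apply/eqP. Qed.

Let half_mem : spectral_lower_bounds adj (phi ^+ 2 / 8 / 2).
Proof.
apply: spectral_lower_bounds_half; first by rewrite divr_gt0 ?exprn_gt0.
by move=> F f uF fF; exact: cheeger.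
Qed.

Let ub1 : ubound (spectral_lower_bounds adj) (1 : R).
Proof.
have ptF : supp (pt o) [:: o] by move=> x; rewrite inE /pt => /negbTE ->.
move=> l /(_ _ (supp_ell2 (F := [:: o]) isT ptF)).
have [-> ->] := inner_supp (F := [:: o]) isT ptF.
rewrite !big_seq1 pt_id expr1n mulr1 mul1r => /le_trans; apply.
by rewrite gerBl; apply: avg_ge0; exact: pt_ge0.
Qed.

(** The supremum of the lower bounds is itself one, since each defining condition is closed; hence
    [xget] does not return its default 0. *)
Let lamP : (spectral_lower_bounds adj `&` ubound (spectral_lower_bounds adj))
  lam.
Proof.
apply: xgetPex; set S := spectral_lower_bounds adj : set R.
have S0 : S !=set0 by eexists; exact: half_mem.
have Sub : has_ubound S by eexists; exact: ub1.
exists (sup S); split; last exact: ub_le_sup.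
move=> f f2; have [u1 _] := usum_ell2 f2.
have i0 : 0 <= inner f f.
  have z : usum (fun _ : V => 0 : R) 0.
    by have := @usum_supp R V (fun=> 0) [::] isT (fun _ _ => erefl);
      rewrite big_nil.
  apply: (le_usum z u1) => e F0 e0; exists (undup F0); rewrite undup_uniq.
  split => // [x|]; first by rewrite mem_undup.
  rewrite big1// addr_ge0 ?(ltW e0)// sumr_ge0// => x _.
  by rewrite -expr2 sqr_ge0.
have [i1|inz] := eqVneq (inner f f) 0.
  by have [l /(_ f f2)] := S0; rewrite i1 !mulr0.
have ip : 0 < inner f f by rewrite lt_def inz.
rewrite -ler_pdivlMr//; apply: ge_sup => // l /(_ f f2).
by rewrite ler_pdivlMr.
Qed.

Lemma spectral_bottom_gt0 : 0 < lam.
Proof. by apply: lt_le_trans (lamP.2 _ half_mem);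
  rewrite !divr_gt0 ?exprn_gt0. Qed.

Lemma spectral_bottom_le1 : lam <= 1.
Proof. exact: ub1 lamP.1. Qed.

Lemma spectral_bottom_gap F (f : V -> R) : uniq F -> supp f F ->
  lam * \sum_(x <- F) f x ^+ 2 <= \sum_(x <- F) f x * (f x - avg f x).
Proof.
move=> uF fF; have [<- <-] := inner_supp uF fF.
exact: lamP.1 (supp_ell2 uF fF).
Qed.

End SpectralBottom.

(** * The connective constant *)

Section ConnectiveConstant.
Variables (R : realType) (V : choiceType) (adj : rel V) (nb : V -> seq V).
Variable d : nat.
Hypotheses (adj_sym : symmetric adj) (adj_irr : irreflexive adj)
  (nb_uniq : forall x, uniq (nb x))
  (mem_nb : forall x y, (y \in nb x) = adj x y)
  (nb_size : forall x, size (nb x) = d) (d_gt2 : (2 < d)%N)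
  (V_inf : infinite_set [set: V])
  (conn : graph_connected adj) (trans : vertex_transitive adj).
Variable o : V.

Local Notation pt := (@pt R V).
Local Notation green := (@green R V nb).
Local Notation saw := (saw nb).
Local Notation s n := ((size (saw [::] n o))%:R : R).
Local Notation mu := (connective_constant R adj o).

Let d_gt0 : (0 < d)%N. Proof. exact: ltn_trans d_gt2. Qed.
Let d3 : 3 <= d%:R :> R. Proof. by rewrite ler_nat. Qed.
Let dR_gt0 : 0 < d%:R :> R. Proof. by rewrite ltr0n. Qed.
Let q_gt0 : 0 < d%:R - 1 :> R. Proof. by rewrite subr_gt0 ltr1n ltnW. Qed.
Let predE : (d.-1)%:R = d%:R - 1 :> R.
Proof. by rewrite -[in RHS](prednK d_gt0) -natr1 addrK. Qed.

Lemma num_sawE n : num_saw adj o n = size (saw [::] n o).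
Proof.
apply: card_fset_set_seq; first exact: saw_uniq.
move=> p; rewrite (mem_saw mem_nb); split => [[/eqP-> -> ->]|].
  by apply/hasPn.
by move=> /and4P[/eqP].
Qed.

Lemma connective_constantP : [/\ 1 <= mu, forall n, mu ^+ n <= s n
  & forall rho, mu < rho -> exists B, 0 < B /\ forall n, s n <= B * rho ^+ n].
Proof.
have s1 n : 1 <= s n by rewrite ler1n (size_saw_gt0 mem_nb).
have smul m n : s (m + n)%N <= s m * s n.
  by rewrite -natrM ler_nat (size_saw_add nb_uniq mem_nb).
have [L [L1 /cvg_lim sL LB LU]] := fekete s1 smul.
suff -> : mu = L by [].
rewrite /connective_constant -[RHS]sL//.
rewrite (_ : (fun n => _) = (fun n => s n `^ n%:R^-1))//.
by apply/funext => n; rewrite num_sawE.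
Qed.

Let mu1 : 1 <= mu. Proof. by case: connective_constantP. Qed.
Let mu0 : 0 < mu. Proof. exact: lt_le_trans mu1. Qed.

Let sS_le n : (size (saw [::] n.+1 o) <= d * d.-1 ^ n)%N.
Proof.
rewrite size_sawS; apply: (@leq_trans (\sum_(y <- nb o) d.-1 ^ n)%N).
  rewrite big_mkcond /= big_seq [leqRHS]big_seq; apply: leq_sum => y.
  rewrite mem_nb => oy; case: ifP => // _.
  by apply: (size_saw_avoid adj_sym mem_nb nb_size _ (mem_head _ _) oy).
by rewrite big_const_seq iter_addn_0 count_predT nb_size mulnC.
Qed.

Lemma connective_constant_le : mu <= d%:R - 1.
Proof.
have [_ LB _] := connective_constantP.
apply: (@expr_le_ratio R mu (d%:R - 1) mu d%:R (ltW mu0) q_gt0 mu0) => k.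
rewrite -exprS; apply: (le_trans (LB _)).
by rewrite -predE -natrX -natrM ler_nat.
Qed.

Let circuit_aut (phi : V -> V) c : graph_automorphism adj phi ->
  circuit adj c -> circuit adj (map phi c).
Proof.
move=> [bphi hphi] [/andP[cc uc] sc]; split; last by rewrite size_map.
apply/andP; split; last by rewrite map_inj_uniq//; exact: bij_inj.
by rewrite cycle_map; apply: etrans cc; apply: eq_cycle => x y /=; rewrite hphi.
Qed.

Lemma connective_constant_circuit c : circuit adj c -> mu < d%:R - 1.
Proof.
move=> cc; have [_ LB _] := connective_constantP.
have d1 : (1 < d)%N by exact: ltnW.
set l := size c; pose K := (d.-1 ^ l).-1.
have dp : (1 < d.-1)%N by lia.
have KE : (K.+1 = d.-1 ^ l)%N by rewrite prednK// expn_gt0 ltnW.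
have Kpos : (0 < K)%N by have := ltn_expl l dp; have := cc.2; rewrite -KE -/l;
  lia.
(* [Q] supplies the predecessor that [size_saw_circuit] asks for; it holds after one step, hence the
   lengths [(k * l).+1] below. *)
pose Q (A : seq V) x := exists2 x', x' \in A & adj x' x.
have Qstep A x y : Q A x -> adj x y -> Q (x :: A) y.
  by move=> _ xy; exists x => //; exact: mem_head.
have QK A x : Q A x -> (size (saw A l x) <= K)%N.
  move=> [x' x'A xx']; rewrite -ltnS KE.
  have [y yc] : exists y, y \in c by case: (c) cc => [[_]//|y c' _]; exists y;
    exact: mem_head.
  have [phi [aphi phiy]] := trans y x.
  have := @size_saw_circuit _ _ _ _ adj_sym adj_irr nb_uniq mem_nb nb_size
    (map phi c) x d1 (circuit_aut aphi cc) _ A x' x'A xx'.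
  by rewrite size_map => ->//; rewrite -phiy map_f.
have bound k A x : Q A x -> (size (saw A (k * l) x) <= K ^ k)%N.
  move=> QA; elim: k => [|k IH]; first by [].
  rewrite mulSn addnC expnSr; apply: (leq_trans (size_saw_mul mem_nb _ Qstep QK
    QA)).
  by rewrite leq_mul2r IH orbT.
have sk k : (size (saw [::] (k * l).+1 o) <= d * K ^ k)%N.
  rewrite size_sawS; apply: (@leq_trans (\sum_(y <- nb o) K ^ k)%N).
    rewrite big_mkcond /= big_seq [leqRHS]big_seq; apply: leq_sum => y.
    rewrite mem_nb => oy; case: ifP => // _; apply: bound.
    by exists o; rewrite ?mem_head.
  by rewrite big_const_seq iter_addn_0 count_predT nb_size mulnC.
have muK : mu ^+ l <= K%:R.
  apply: (@expr_le_ratio R _ K%:R mu d%:R) => //;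
    rewrite ?exprn_ge0 ?ltr0n ?ltW//.
  move=> k; rewrite -exprM mulnC -exprS; apply: (le_trans (LB _)).
  by rewrite -natrX -natrM ler_nat.
rewrite lt_neqAle connective_constant_le andbT; apply/eqP => muq.
move: muK; rewrite muq -predE -natrX -KE ler_nat; lia.
Qed.

Lemma connective_constant_no_circuit : (forall c, ~ circuit adj c) ->
  mu = d%:R - 1.
Proof.
move=> nc; apply/eqP; rewrite eq_le connective_constant_le leNgt.
apply/negP => muq; have [_ _ LU] := connective_constantP.
have [B [B0 hB]] : exists B, 0 < B /\ forall n, s n <=
  B * ((mu + (d%:R - 1)) / 2) ^+ n.
  by apply: LU; lra.
suff : d%:R - 1 <= (mu + (d%:R - 1)) / 2 by lra.
apply: (@expr_le_ratio R _ _ 1 B) => //.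
- exact: ltW.
- by rewrite divr_gt0// addr_gt0.
move=> k; rewrite mul1r; apply: le_trans (hB k).
case: k => [|n]; first by rewrite expr0 ler1n (size_saw_gt0 mem_nb).
rewrite size_sawS natr_sum.
apply: (@le_trans _ _ (\sum_(y <- nb o) (d%:R - 1) ^+ n)).
  rewrite big_const_seq count_predT nb_size iter_addr_0 -[leRHS]mulr_natl exprS.
  by rewrite ler_wpM2r ?gerBl// exprn_ge0// ltW.
rewrite [leRHS]big_mkcond big_seq [leRHS]big_seq; apply: ler_sum => y.
rewrite mem_nb => oy; rewrite inE; case: eqVneq oy => [->|_ oy /=].
  by rewrite adj_irr.
rewrite (size_saw_no_circuit R adj_sym adj_irr nb_uniq mem_nb nb_size)//.
by move=> c /nc.
Qed.

Lemma girth_infty : (forall c, ~ circuit adj c) -> girth R adj = +oo%E.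
Proof.
move=> nc; rewrite /girth (_ : [set c | _] = set0) ?image_set0 ?ereal_inf0//.
by apply/seteqP; split => // c /nc.
Qed.

Lemma girth_nat c : circuit adj c -> exists g : nat, [/\ (2 < g)%N,
  girth R adj = g%:R%:E & forall c, circuit adj c -> (g <= size c)%N].
Proof.
move=> cc; pose P n := `[< exists c, circuit adj c /\ size c = n >].
have exP : exists n, P n by exists (size c); apply/asboolP; exists c.
case: (ex_minnP exP) => g /asboolP[c0 [cc0 sc0]] gmin.
have hg c' : circuit adj c' -> (g <= size c')%N.
  by move=> cc'; apply: gmin; apply/asboolP; exists c'.
exists g; split => //; first by rewrite -sc0; exact: cc0.2.
apply/eqP; rewrite eq_le; apply/andP; split.
  by apply: ereal_inf_lbound; exists c0; rewrite ?sc0.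
by apply: le_ereal_inf_tmp => _ [c' /hg gc' <-]; rewrite lee_fin ler_nat.
Qed.

(** It follows from [lam ^- 2 >= 4 ^ i] and [ln 2 >= 1 / 2]; for [i = 0] the former is
    [lam <= 1]. *)
Lemma log_lower_bound lam i : 0 < lam -> lam <= 1 ->
  (i == 0)%N || (2 ^+ i < lam^-1) -> (i.+1)%:R / 2 <= ln (1 + lam ^- 2) :> R.
Proof.
move=> l0 l1 hi.
have lV : 1 <= lam^-1 by rewrite invf_ge1.
have ln2 : 1 / 2 <= ln 2 :> R.
  have := @le_ln1Dx R (- (1 / 2)); rewrite (_ : 1 + - (1 / 2) = 2^-1);
    last by field.
  by rewrite lnV ?posrE//; lra.
have lV2 : 1 <= lam ^- 2 by rewrite -exprVn exprn_ege1.
case: i hi => [_|i /= hi].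
  by apply: (le_trans ln2); rewrite ler_ln ?posrE//; lra.
have : ln (2 ^+ (2 * i.+1)) <= ln (1 + lam ^- 2).
  rewrite ler_ln ?posrE ?exprn_gt0//; last by lra.
  rewrite mulnC exprM -exprVn -[leLHS]add0r lerD// lerXn2r ?nnegrE ?exprn_ge0
    ?invr_ge0 ?ltW//.
apply: le_trans; rewrite lnXn// -[ln 2 *+ _]mulr_natr natrM.
move: ln2; set l2 := ln 2 => ln2; rewrite -(natr1 i.+1) -(natr1 i).
by have := ler0n R i; set a := i%:R; nra.
Qed.

Hypotheses (degE : forall x, degree adj x = d) (namen : ~ amenable R adj d).
Local Notation lam := (spectral_bottom R adj).

Lemma connective_constant_ge g : (2 < g)%N ->
  (forall c, circuit adj c -> (g <= size c)%N) ->
  1 <= ((d%:R - 1)^-1 + 16 * 528 * (ln (1 + lam ^- 2) * g%:R^-1 / d%:R)) * mu.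
Proof.
move=> g2 hg; have [_ _ LU] := connective_constantP.
have lam0 : 0 < lam := spectral_bottom_gt0 adj_sym nb_uniq mem_nb nb_size d_gt0
  degE namen o.
have lam1 : lam <= 1 := spectral_bottom_le1 adj_sym nb_uniq mem_nb nb_size
  d_gt0 degE namen o.
have gap := spectral_bottom_gap adj_sym nb_uniq mem_nb nb_size d_gt0 degE namen
  o.
(* The largest [i] with [8 i < g]: there are no circuits of length at most [8 i], and
   [g <= 8 (i + 1)]. *)
pose i := (g.-1 %/ 8)%N.
have gi : (8 * i < g <= 8 * i.+1)%N by rewrite /i; lia.
have g0 : 0 < g%:R :> R by rewrite ltr0n; lia.
have gi8 : g%:R <= 8 * (i.+1)%:R :> R by rewrite -natrM ler_nat; lia.
set X := _ / d%:R.
have [|] := boolP ((i == 0)%N || (2 ^+ i < lam^-1)).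
  move=> /(log_lower_bound lam0 lam1) hL.
  have degA := growth_ge_degree adj_sym nb_uniq mem_nb nb_size d_gt0 V_inf conn
    trans mu0 LU.
  (* Here the logarithm is at least [(i + 1) / 2 >= g / 16], which is where the factor 16 comes
     from. *)
  have X528 : 528 / d%:R <= 16 * 528 * X.
    rewrite /X mulrA ler_wpM2r ?invr_ge0//.
    have gV : 0 <= g%:R^-1 :> R by rewrite invr_ge0 ltW.
    have h : g%:R / 16 <= ln (1 + lam ^- 2) by lra.
    by have := ler_wpM2r gV h; rewrite mulrAC mulfV ?gt_eqF//; lra.
  have q0 : 0 <= (d%:R - 1)^-1 :> R by rewrite invr_ge0 ltW.
  apply: (@le_trans _ _ (528 / d%:R * mu)).
    by rewrite mulrAC ler_pdivlMr// mul1r; lra.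
  by rewrite ler_wpM2r ?(ltW mu0)//; lra.
rewrite negb_or -lt0n -leNgt => /andP[i0 lami].
pose Y : R := (2 ^+ i)^-1.
have p2i : 0 < 2 ^+ i :> R by rewrite exprn_gt0.
have Y0 : 0 < Y by rewrite invr_gt0.
have hL := log_lower_bound (i := 0) lam0 lam1 isT.
have loops x x' M : adj x' x -> green [::
  x'] d%:R^-1 M (pt x) x <= d%:R / (d%:R - 1) + Y.
  (* With [h = 4 i] and [d - 1 >= 2], [Y ^+ 2 * (d - 1) ^+ h >= 4 ^ i >= lam ^- 2]. *)
  move=> xx'; apply: (green_loop_le adj_sym adj_irr nb_uniq mem_nb nb_size
    d_gt2 lam0 gap (h := (4 * i)%N)) => //.
  - by rewrite muln_gt0.
  - move=> c /hg; apply: leq_trans; rewrite -mulnDl; by case/andP: gi.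
  have q2 : 2 <= d%:R - 1 :> R by rewrite lerBrDr natr1.
  apply: (@le_trans _ _ ((2 ^+ i) ^+ 2)).
    by rewrite -exprVn lerXn2r// nnegrE ?invr_ge0 ltW.
  have -> : (2 ^+ i) ^+ 2 = Y ^+ 2 * 2 ^+ (4 * i) :> R.
    by rewrite (mulnC 4) exprM /Y; field; rewrite gt_eqF.
  rewrite ler_wpM2l ?sqr_ge0// lerXn2r ?nnegrE//; lra.
have dq : d%:R / (d%:R - 1) = 1 + (d%:R - 1)^-1 :> R by field; rewrite gt_eqF.
have qV : 0 <= (d%:R - 1)^-1 :> R by rewrite invr_ge0 ltW.
have a1 : 1 <= d%:R / (d%:R - 1) + Y by rewrite dq; lra.
have lamV : 0 < lam^-1 by rewrite invr_gt0.
have := growth_ge_loops mem_nb nb_size d_gt0 mu0 LU a1 lamV loops.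
move=> /(_ (fun M => green_le_gap adj_sym mem_nb lam0 gap M o)).
move=> /le_trans; apply; rewrite ler_wpM2r ?(ltW mu0)// mulrDl.
have -> : d%:R / (d%:R - 1) / d%:R = (d%:R - 1)^-1 :> R.
  by field; rewrite !gt_eqF.
rewrite lerD2l /X mulrA ler_wpM2r ?invr_ge0//.
have Yi : Y * (i.+1)%:R <= 1.
  rewrite mulrC ler_pdivrMr// mul1r -natrX ler_nat.
  by rewrite ltn_expl.
(* Since [2 ^ i >= i + 1], [Y] is at most [8 / g], and the logarithm is at least [1 / 2]. *)
have Yg : Y <= 8 * g%:R^-1.
  rewrite ler_pdivlMr//.
  by have := ler_wpM2l (ltW Y0) gi8; lra.
have gV : 0 <= g%:R^-1 :> R by rewrite invr_ge0.
have := ler_wpM2r gV hL.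
by lra.
Qed.

End ConnectiveConstant.

Theorem theorem7p1 (R : realType) :
  exists C : R, 0 < C /\
  forall (V : choiceType) (adj : rel V) (Delta : nat) (o : V),
    simple_graph adj ->
    infinite_set [set: V] ->
    locally_finite adj ->
    graph_connected adj ->
    vertex_transitive adj ->
    (forall x, degree adj x = Delta) ->
    (3 <= Delta)%N ->
    ~ amenable R adj Delta ->
    let mu : R := connective_constant R adj o in
    let lambda : R := spectral_bottom R adj in
    let inv_girth : R := fine ((girth R adj)^-1)%E in
    (((Delta%:R - 1)^-1
        + C * (ln (1 + lambda ^- 2) * inv_girth / Delta%:R))^-1 <= mu
     /\ mu <= Delta%:R - 1)
    /\ (mu = Delta%:R - 1 <-> is_tree adj)
    /\ (is_tree adj <-> girth R adj = +oo%E).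
Proof.
exists (16 * 528); split; first by rewrite mulr_gt0 ?ltr0n.
move=> V adj d o [adj_sym adj_irr] V_inf lf conn trans degE d_gt2
  namen mu lambda inv_girth.
pose nb x : seq V := fset_set (nbrs adj x).
have nb_uniq x : uniq (nb x) by exact: fset_uniq.
have mem_nb x y : (y \in nb x) = adj x y.
  by rewrite /nb in_fset_set//; apply/idP/idP; rewrite inE.
have nb_size x : size (nb x) = d by rewrite -(degE x).
have mu_le : mu <= d%:R - 1.
  exact: (connective_constant_le R adj_sym nb_uniq mem_nb nb_size).
have q0 : 0 < d%:R - 1 :> R by rewrite subr_gt0 ltr1n ltnW.
have [nc|/existsNP[c /contrapT cc]] := pselect (forall c, ~ circuit adj c).
  have muE : mu = d%:R - 1.
    exact: (connective_constant_no_circuit R adj_sym adj_irr nb_uniq mem_nb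
      nb_size).
  have tree : is_tree adj by split => // -[c /nc].
  have gy := girth_infty R nc.
  split; last by split; split.
  (* The inverse of the infinite girth is 0, so the lower bound reduces to [d - 1]. *)
  split => //; rewrite /inv_girth gy invey /= mulr0 mul0r mulr0 addr0 invrK.
  by rewrite muE.
have ntree : ~ is_tree adj by move=> [_]; apply; exists c.
have mu_lt : mu < d%:R - 1.
  exact: (connective_constant_circuit R adj_sym adj_irr nb_uniq mem_nb nb_size
    d_gt2 V_inf conn trans o cc).
have [g [g2 gE hg]] := girth_nat R cc.
split; last first.
  split; split => //; first by move=> E; rewrite E ltxx in mu_lt.
  by rewrite gE.
split => //; rewrite /inv_girth gE fine_invr.
have := connective_constant_ge adj_sym adj_irr nb_uniq mem_nb nb_size d_gt2
  V_inf
  conn trans o degE namen g2 hg.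
rewrite -/mu -/lambda; set X := _^-1 + _ => h.
(* Inverting [1 <= X * mu] requires [X > 0]; otherwise [X * mu <= 0], a contradiction. *)
have [X0|X0] := leP X 0; last by rewrite -[X^-1]mul1r ler_pdivrMr// mulrC.
have mu0 : 0 < mu.
  have [mu1 _ _] := connective_constantP R nb_uniq mem_nb V_inf conn trans o.
  exact: lt_le_trans mu1.
have : X * mu <= 0 by rewrite pmulr_lle0.
by lra.
Qed.
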